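(* Let $\mathfrak U$ be the Urysohn space of diameter $1$, $\mathbb Q\mathfrak U$ its countable dense rational counterpart, and $L$ a computable relational continuous signature all of whose symbols have continuity modulus $\mathsf{id}$. Let $\mathcal{SC}_{\mathbb Q\mathfrak U}$ be the $\mathsf{Iso}(\mathbb Q\mathfrak U)$-invariant Borel subset of $\mathfrak U_L$ defined in the context. Then the set of indices of computable structures from $\mathcal{SC}_{\mathbb Q\mathfrak U}$ is hyperarithmetical.
   Context: $\mathfrak U$ is the Urysohn space of diameter $1$ (the unique Polish metric space of diameter $1$ that is universal and ultrahomogeneous). $\mathbb Q\mathfrak U$ is the rational Urysohn space of diameter $1$ (the countable ultrahomogeneous metric space universal for countable metric spaces with rational distances and diameter $\le1$), embedded as a dense subset of $\mathfrak U$ so that every isometry of $\mathbb Q\mathfrak U$ extends to one of $\mathfrak U$ and $\mathsf{Iso}(\mathbb Q\mathfrak U)$ is dense in $\mathsf{Iso}(\mathfrak U)$. Fix an identification of $\mathbb Q\mathfrak U$ with $\omega$ under which all relations on $\mathbb Q\mathfrak U$ that are first-order definable from the relations $d(x,y)\le q$, $d(x,y)\ge q$ ($q\in\mathbb Q\cap[0,1]$) are decidable (such a presentation exists). $L$-structures on $\mathfrak U$ interpret $d$ as the metric and each predicate symbol $R_j$ as a map $\mathfrak U^n\to[0,1]$ that is $1$-Lipschitz in each variable separately (continuity modulus $\mathsf{id}$). Formulas are built from $0,1$ and atomic formulas by the connectives $x/2$, $x\dot-y=\max(x-y,0)$, $\min$, $\max$, $|x-y|$, $1-x$, $\min(x+y,1)$,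 truncated multiplication by positive rationals, and the quantifiers $\sup_x,\inf_x$; $\phi^M(\bar a)$ is the value in $M$. $\mathfrak U_L$ is the Polish space of all $L$-structures on $\mathfrak U$ with the coarsest topology making all maps $M\mapsto R_j^M(\bar s)$, $\bar s\in\mathbb Q\mathfrak U$, continuous. Let $\mathcal U$ be the family of functions (grey subsets) $\sigma:\mathfrak U_L\to[0,1]$ that are maxima of finitely many functions of the forms $M\mapsto|R_j^M(\bar s)-q|$ and $M\mapsto 1\dot-|R_j^M(\bar s)-q|$, with $\bar s$ a tuple from $\mathbb Q\mathfrak U$ and $q\in\mathbb Q\cap[0,1]$. Let $\mathcal U_{\mathbb Q}$ be the family of all cones $\sigma_{<r}=\{M:\sigma(M)<r\}$ and $\sigma_{>r}=\{M:\sigma(M)>r\}$, $\sigma\in\mathcal U$, $r\in\mathbb Q^+\cap[0,1]$, coded by natural numbers through a fixed computable coding of the expressions defining them. A structure $M\in\mathfrak U_L$ is computable if the set $Sat_M(\mathcal U_{\mathbb Q})=\{U\in\mathcal U_{\mathbb Q}:M\in U\}$ is computable (as a set of codes), and $e\in\omega$ is an index of $M$ if the partial computable function $\varphi_e$ is the characteristic function of $Sat_M(\mathcal U_{\mathbb Q})$. $\mathcal{SC}_{\mathbb Q\mathfrak U}$ is the set of all $L$-structures $M$ on $\mathfrak U$ satisfying the following, with $S=\mathbb Q\mathfrak U$: for every $n$ and every rational $\varepsilon>0$ there are a finite set $\{\bar a_i:i\in I\}$ of $n$-tuples from $S$ and conditions $\phi_i(\bar x)\le\delta_i$ ($i\in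 I$, $I$ finite, $\phi_i$ an $L$-formula with $|\bar x|=n$, $\delta_i$ rational) with $\phi_i^M(\bar a_i)\le\delta_i$ for all $i\in I$, such that (1) every $n$-tuple from $S$ satisfies in $M$ at least one of the conditions $\phi_i(\bar x)\le\delta_i$; and (2) whenever $i\in I$, $\bar a$ is an $n$-tuple from $S$ with $\phi_i^M(\bar a)\le\delta_i$, and $\bar c$ is an $(n+1)$-tuple from $S$ with $\phi_i^M(c_1,\dots,c_n)\le\delta_i$, then for every finite set $\Delta$ of $L$-formulas $\phi(\bar y)$, $|\bar y|=n+1$, with $\phi^M(\bar c)=0$ for all $\phi\in\Delta$, there is an $(n+1)$-tuple $\bar b$ from $S$ with $\max_{j\le n}d(a_j,b_j)\le\varepsilon$ and $\phi^M(\bar b)=0$ for all $\phi\in\Delta$. *)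

(* Defs.v *)
From HB Require Import structures.
From Stdlib Require Cantor.
From mathcomp Require Import all_boot all_order all_algebra.
From mathcomp Require Import all_classical all_reals all_analysis.

Set Implicit Arguments.
Unset Strict Implicit.
Unset Printing Implicit Defensive.

Import Order.TTheory GRing.Theory Num.Theory.

Local Open Scope classical_set_scope.

(** * Computability relative to an oracle *)

Definition pair_code (x y : nat) : nat := Cantor.to_nat (x, y).

Definition seq_code (s : seq nat) : nat :=
  foldr (fun x c => (pair_code x c).+1) 0%N s.

(* Only used for nonnegative rationals, on which it is injective. *)
Definition rat_code (r : rat) : nat :=
  pair_code `|numq r|%N `|denq r|%N.

(* Programs for the unary partial recursive functions; several arguments are
   passed through the Cantor pairing. *)
Inductive prog : Type :=
| PZero | PSucc | PFst | PSnd | POracle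
| PPair of prog & prog
| PComp of prog & prog
| PPrec of prog & prog
| PMu of prog.

(* [sem A p x y]: the program p with oracle A halts on x with output y.
   [PPrec f g] maps <a, 0> to f(a), and <a, n + 1> to g(<a, <n, z>>) where z is
   its value at <a, n>; [PMu f] maps x to the least n such that f(<x, n>) = 0,
   all the previous values of f being defined. *)
Fixpoint sem (A : set nat) (p : prog) (x y : nat) : Prop :=
  match p with
  | PZero => y = 0%N
  | PSucc => y = x.+1
  | PFst => y = (Cantor.of_nat x).1
  | PSnd => y = (Cantor.of_nat x).2
  | POracle => (A x /\ y = 1%N) \/ (~ A x /\ y = 0%N)
  | PPair f g => exists u v, [/\ sem A f x u, sem A g x v & y = pair_code u v]
  | PComp f g => exists u, sem A g x u /\ sem A f u y
  | PPrec f g =>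
      let a := (Cantor.of_nat x).1 in
      (fix rec (n : nat) (y : nat) : Prop :=
         match n with
         | 0%N => sem A f a y
         | n'.+1 => exists z, rec n' z /\
                      sem A g (pair_code a (pair_code n' z)) y
         end) (Cantor.of_nat x).2 y
  | PMu f => sem A f (pair_code x y) 0%N /\
      forall m, (m < y)%N -> exists v, sem A f (pair_code x m) v.+1
  end.

Fixpoint prog_code (p : prog) : nat :=
  match p with
  | PZero => pair_code 0 0
  | PSucc => pair_code 1 0
  | PFst => pair_code 2 0
  | PSnd => pair_code 3 0
  | POracle => pair_code 4 0
  | PPair f g => pair_code 5 (pair_code (prog_code f) (prog_code g))
  | PComp f g => pair_code 6 (pair_code (prog_code f) (prog_code g))
  | PPrec f g => pair_code 7 (pair_code (prog_code f) (prog_code g))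
  | PMu f => pair_code 8 (prog_code f)
  end.

(* [phi_rel A e x y] is phi_e^A(x) = y; a number that is not the code of a
   program is an index of the empty function. *)
Definition phi_rel (A : set nat) (e x y : nat) : Prop :=
  exists p, prog_code p = e /\ sem A p x y.

Definition phi (e x y : nat) : Prop := phi_rel set0 e x y.

Definition char_index_rel (A : set nat) (e : nat) (X : set nat) : Prop :=
  forall x, (X x -> phi_rel A e x 1) /\ (~ X x -> phi_rel A e x 0).

Definition char_index (e : nat) (X : set nat) : Prop :=
  char_index_rel set0 e X.

Definition computable (X : set nat) : Prop := exists e, char_index e X.

Definition turing_le (X A : set nat) : Prop :=
  exists e, char_index_rel A e X.

Definition jump (A : set nat) : set nat := [set e | exists y, phi_rel A e e y].

(** * Hyperarithmetical sets: Kleene's O and the H-sets *)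

Inductive kleeneO : nat -> Prop :=
| kleeneO_one : kleeneO 1%N
| kleeneO_succ a : kleeneO a -> kleeneO (2 ^ a)%N
| kleeneO_lim e (f : nat -> nat) :
    (forall n, phi e n (f n)) ->
    (forall n, kleeneO (f n)) ->
    (forall n, ltO (f n) (f n.+1)) ->
    kleeneO (3 * 5 ^ e)%N
with ltO : nat -> nat -> Prop :=
| ltO_succ a : kleeneO a -> ltO a (2 ^ a)%N
| ltO_lim e (f : nat -> nat) m :
    (forall n, phi e n (f n)) ->
    (forall n, kleeneO (f n)) ->
    (forall n, ltO (f n) (f n.+1)) ->
    ltO (f m) (3 * 5 ^ e)%N
| ltO_trans a b c : ltO a b -> ltO b c -> ltO a c.

(* Graph of a |-> H_a. *)
Inductive Hset : nat -> set nat -> Prop :=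
| Hset_one : Hset 1%N set0
| Hset_succ a A : Hset a A -> Hset (2 ^ a)%N (jump A)
| Hset_lim e (f : nat -> nat) (A : nat -> set nat) :
    (forall n, phi e n (f n)) ->
    (forall n, Hset (f n) (A n)) ->
    Hset (3 * 5 ^ e)%N [set z | A (Cantor.of_nat z).2 (Cantor.of_nat z).1].

Definition hyperarithmetical (X : set nat) : Prop :=
  exists a A, [/\ kleeneO a, Hset a A & turing_le X A].

(** * Urysohn spaces of diameter 1 *)

Local Open Scope ring_scope.

Section Urysohn.
Context {R : realType}.

Definition isometric_map (T T' : Type) (d : T -> T -> R) (d' : T' -> T' -> R)
    (f : T -> T') : Prop :=
  forall x y, d' (f x) (f y) = d x y.

Definition isometry (T : Type) (d : T -> T -> R) (g : T -> T) : Prop :=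
  isometric_map d d g /\ bijective g.

Definition ultrahomogeneous (T : Type) (d : T -> T -> R) : Prop :=
  forall (n : nat) (x y : 'I_n -> T),
    (forall i j, d (x i) (x j) = d (y i) (y j)) ->
    exists2 g, isometry d g & forall i, g (x i) = y i.

(* [sup] is 0 on unbounded sets, so [diameter d = 1] entails boundedness. *)
Definition diameter (T : Type) (d : T -> T -> R) : R :=
  sup [set r | exists x y, r = d x y].

Definition complete_space (V : metricType R) : Prop :=
  forall F : set_system V, ProperFilter F -> cauchy F -> exists l : V, F --> l.

Definition separable_space (V : metricType R) : Prop :=
  exists2 D : set V, countable D & dense D.

Definition Polish_metric (V : metricType R) : Prop :=
  complete_space V /\ separable_space V.

Definition urysohn1 (U : metricType R) : Prop :=
  [/\ Polish_metric U,
      diameter (@mdist R U) = 1,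
      (forall V : metricType R, Polish_metric V ->
         (forall x y : V, mdist x y <= 1) ->
         exists f : V -> U, isometric_map mdist mdist f)
    & ultrahomogeneous (@mdist R U)].

Definition is_rational (x : R) : Prop := exists r : rat, x = ratr r.

(* An enumeration q : nat -> U stands both for the inclusion of the rational
   Urysohn space in U and for its identification with nat. *)
Definition qdist (U : metricType R) (q : nat -> U) (m n : nat) : R :=
  mdist (q m) (q n).

Definition rational_urysohn1 (U : metricType R) (q : nat -> U) : Prop :=
  [/\ injective q,
      (forall m n, is_rational (qdist q m n) /\ qdist q m n <= 1),
      (forall V : metricType R, countable [set: V] ->
         (forall x y : V, is_rational (mdist x y) /\ mdist x y <= 1) ->
         exists f : V -> nat, isometric_map mdist (qdist q) f)
    & ultrahomogeneous (qdist q)].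

Definition extends_along (U : metricType R) (q : nat -> U)
    (h : nat -> nat) (g : U -> U) : Prop :=
  forall m, g (q m) = q (h m).

(* Density in Iso(U) is for the topology of pointwise convergence. *)
Definition good_embedding (U : metricType R) (q : nat -> U) : Prop :=
  [/\ dense (range q),
      (forall h, isometry (qdist q) h ->
         exists2 g : U -> U, isometry mdist g & extends_along q h g)
    & (forall (g : U -> U), isometry mdist g ->
       forall (n : nat) (x : 'I_n -> U) (eps : R), 0 < eps ->
       exists h (g' : U -> U),
         [/\ isometry (qdist q) h, isometry mdist g', extends_along q h g'
           & forall i, mdist (g' (x i)) (g (x i)) < eps])].

End Urysohn.

(** * First-order formulas in the relations d(x,y) <= r and d(x,y) >= r *)

Inductive fof : Type :=
| FoLe (r : rat) of (0 <= r <= 1) & nat & nat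
| FoGe (r : rat) of (0 <= r <= 1) & nat & nat
| FoNot of fof
| FoAnd of fof & fof
| FoEx of nat & fof.

Fixpoint fof_code (f : fof) : nat :=
  match f with
  | FoLe r _ i j => pair_code 0 (pair_code (rat_code r) (pair_code i j))
  | FoGe r _ i j => pair_code 1 (pair_code (rat_code r) (pair_code i j))
  | FoNot f => pair_code 2 (fof_code f)
  | FoAnd f g => pair_code 3 (pair_code (fof_code f) (fof_code g))
  | FoEx i f => pair_code 4 (pair_code i (fof_code f))
  end.

Fixpoint fof_sat (R : realType) (U : metricType R) (q : nat -> U)
    (f : fof) (s : nat -> nat) : Prop :=
  match f with
  | FoLe r _ i j => qdist q (s i) (s j) <= ratr r
  | FoGe r _ i j => ratr r <= qdist q (s i) (s j)
  | FoNot f => ~ fof_sat q f s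
  | FoAnd f g => fof_sat q f s /\ fof_sat q g s
  | FoEx i f => exists m, fof_sat q f (fun k => if k == i then m else s k)
  end.

(* Satisfaction is decidable uniformly in the formula and in the assignment
   (a finite list, completed by 0). *)
Definition decidable_presentation (R : realType) (U : metricType R)
    (q : nat -> U) : Prop :=
  computable [set z | exists (f : fof) (l : seq nat),
    z = pair_code (fof_code f) (seq_code l) /\ fof_sat q f (nth 0%N l)].

(** * Relational continuous signatures and structures on U *)

(* The predicate symbols are the j with [is_symbol j]; [arity j] is irrelevant
   for the other j. *)
Record signature := Signature { is_symbol : pred nat; arity : nat -> nat }.

Definition symbol (L : signature) : Type := {j : nat | is_symbol L j}.

Definition ar (L : signature) (j : symbol L) : nat := arity L (sval j).

Definition computable_signature (L : signature) : Prop :=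
  computable [set j | is_symbol L j] /\
  exists e, forall j, is_symbol L j -> phi e j (arity L j).

Record lstructure (R : realType) (U : metricType R) (L : signature) := Structure {
  interp : forall j : symbol L, (ar j).-tuple U -> R;
  interp_range : forall j x, 0 <= interp (j := j) x <= 1;
  interp_lipschitz : forall (j : symbol L) (i : 'I_(ar j)) (x y : (ar j).-tuple U),
    (forall k, k != i -> tnth x k = tnth y k) ->
    `|interp x - interp y| <= mdist (tnth x i) (tnth y i)
}.

(* [formula L n]: formulas with free variables among x_0, ..., x_(n-1); a
   quantifier binds the last variable. *)
Inductive formula (L : signature) : nat -> Type :=
| CZero n : formula L n
| COne n : formula L n
| CDist n of 'I_n & 'I_n : formula L n
| CRel n (j : symbol L) of (ar j).-tuple 'I_n : formula L n
| CHalf n of formula L n : formula L n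
| CSub n of formula L n & formula L n : formula L n
| CMin n of formula L n & formula L n : formula L n
| CMax n of formula L n & formula L n : formula L n
| CAbsDiff n of formula L n & formula L n : formula L n
| CNeg n of formula L n : formula L n
| CAdd n of formula L n & formula L n : formula L n
| CScale n (r : rat) of (0 < r) & formula L n : formula L n
| CSup n of formula L n.+1 : formula L n
| CInf n of formula L n.+1 : formula L n.

Section Semantics.
Context {R : realType} {U : metricType R} {L : signature}.
Variable M : lstructure U L.

Fixpoint formula_val (n : nat) (f : formula L n) : n.-tuple U -> R :=
  match f in formula _ n return n.-tuple U -> R with
  | CZero _ => fun=> 0
  | COne _ => fun=> 1
  | CDist _ i j => fun a => mdist (tnth a i) (tnth a j)
  | CRel _ j v => fun a => interp M (map_tuple (tnth a) v)
  | CHalf _ f => fun a => formula_val f a / 2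
  | CSub _ f g => fun a => Num.max (formula_val f a - formula_val g a) 0
  | CMin _ f g => fun a => Num.min (formula_val f a) (formula_val g a)
  | CMax _ f g => fun a => Num.max (formula_val f a) (formula_val g a)
  | CAbsDiff _ f g => fun a => `|formula_val f a - formula_val g a|
  | CNeg _ f => fun a => 1 - formula_val f a
  | CAdd _ f g => fun a => Num.min (formula_val f a + formula_val g a) 1
  | CScale _ r _ f => fun a => Num.min (ratr r * formula_val f a) 1
  | CSup _ f => fun a => sup (range (fun x => formula_val f (rcons_tuple a x)))
  | CInf _ f => fun a => inf (range (fun x => formula_val f (rcons_tuple a x)))
  end.

Variable q : nat -> U.

(* Value at a tuple of the rational Urysohn space. *)
Definition evalq (n : nat) (f : formula L n) (s : n.-tuple nat) : R :=
  formula_val f (map_tuple q s).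

(* The (n+1)-tuples are written as an n-tuple followed by one point. *)
Definition SC : Prop :=
  forall (n : nat) (eps : rat), 0 < eps ->
  exists (k : nat) (abar : 'I_k -> n.-tuple nat)
         (f : 'I_k -> formula L n) (delta : 'I_k -> rat),
  [/\ forall i, evalq (f i) (abar i) <= ratr (delta i),
      forall s : n.-tuple nat, exists i, evalq (f i) s <= ratr (delta i)
    & forall (i : 'I_k) (a : n.-tuple nat), evalq (f i) a <= ratr (delta i) ->
      forall (c : n.-tuple nat) (c' : nat), evalq (f i) c <= ratr (delta i) ->
      forall (m : nat) (Delta : 'I_m -> formula L n.+1),
        (forall l, evalq (Delta l) (rcons_tuple c c') = 0) ->
      exists (b : n.-tuple nat) (b' : nat),
        \big[Num.max/0]_(j < n) qdist q (tnth a j) (tnth b j) <= ratr eps /\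
        forall l, evalq (Delta l) (rcons_tuple b b') = 0].

End Semantics.

(** * Basic cones and their codes *)

(* |R_j(s) - r| if [basic_compl] is false, 1 -. |R_j(s) - r| otherwise. *)
Record basic (L : signature) := Basic {
  basic_compl : bool;
  basic_symbol : symbol L;
  basic_args : (ar basic_symbol).-tuple nat;
  basic_rat : rat;
  basic_rat_range : 0 <= basic_rat <= 1
}.

(* sigma_{<r} if [cone_above] is false, sigma_{>r} otherwise, where sigma is
   the maximum of [cone_terms]. *)
Record cone (L : signature) := Cone {
  cone_above : bool;
  cone_terms : seq (basic L);
  cone_terms_nonempty : (0 < size cone_terms)%N;
  cone_rat : rat;
  cone_rat_range : 0 < cone_rat <= 1
}.

Definition basic_code (L : signature) (b : basic L) : nat :=
  pair_code (basic_compl b) (pair_code (sval (basic_symbol b))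
    (pair_code (seq_code (basic_args b)) (rat_code (basic_rat b)))).

Definition cone_code (L : signature) (c : cone L) : nat :=
  pair_code (cone_above c) (pair_code (rat_code (cone_rat c))
    (seq_code [seq basic_code b | b <- cone_terms c])).

Section Indices.
Context {R : realType} {U : metricType R} {L : signature}.
Variable q : nat -> U.

Definition basic_val (b : basic L) (M : lstructure U L) : R :=
  let v := `|interp M (map_tuple q (basic_args b)) - ratr (basic_rat b)| in
  if basic_compl b then Num.max (1 - v) 0 else v.

Definition grey_val (c : cone L) (M : lstructure U L) : R :=
  \big[Num.max/0]_(b <- cone_terms c) basic_val b M.

Definition in_cone (c : cone L) (M : lstructure U L) : Prop :=
  if cone_above c then ratr (cone_rat c) < grey_val c M
  else grey_val c M < ratr (cone_rat c).

Definition Sat (M : lstructure U L) : set nat :=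
  [set z | exists2 c : cone L, cone_code c = z & in_cone c M].

Definition computable_structure (M : lstructure U L) : Prop :=
  computable (Sat M).

Definition index_of (M : lstructure U L) (e : nat) : Prop :=
  char_index e (Sat M).

End Indices.

Definition SC_indices (R : realType) (U : metricType R) (q : nat -> U)
    (L : signature) : set nat :=
  [set e | exists M : lstructure U L,
     [/\ computable_structure q M, SC M q & index_of q M e]].

(* Main.v *)
Require Import Defs.
From Stdlib Require Cantor.
From mathcomp Require Import all_boot all_order all_algebra.
From mathcomp Require Import all_classical all_reals all_analysis.
From mathcomp Require Import lra.

(* The value in M of a formula with k quantifiers and connectives is decided,
   uniformly in k, by k jumps of an arithmetical set: "the value is less than d"
   for a compound formula is an existential quantifier over a condition that is
   decidable in the same question for the immediate subformulas. The reductions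
   to the finite jumps are programs spliced into each other, so their codes are
   computable and the values of all formulas are decided by the sum of the
   finite jumps, the H-set of a notation of omega. An index e determines the
   values of the predicates on the rational Urysohn space by their rational
   cuts; by McShane's extension they come from a structure exactly when they are
   Lipschitz, and e is its index exactly when phi_e answers all the cones
   according to these values. Both this and SC_QU are then arithmetical in the
   sum of the finite jumps, hence decided finitely many jumps above it. *)

Set Implicit Arguments.
Unset Strict Implicit.
Unset Printing Implicit Defensive.

Import Order.TTheory GRing.Theory Num.Theory.

Local Open Scope classical_set_scope.
Local Open Scope nat_scope.

(** The number of jumps behind [arithf] and [arith] is fixed for each single function or predicate.
    An induction on formulas carried out inside [arith] would give one bound for each formula and
    nothing for all formulas at once, whereas [SC] quantifies over formulas. This is why the values
    of formulas are treated by a separate uniform lemma, which works with programs and their codes.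
    For the same reason formulas are replaced by numbers all of which are meaningful, so that
    quantifiers over formulas and tuples become number quantifiers. The index set also quantifies
    over structures, hence over a continuum. This quantifier disappears because an index determines
    the predicates on the dense sequence, and formulas are uniformly continuous: the quantifiers
    over [U] are infima and suprema over the sequence, and the value of a formula at a tuple of the
    sequence depends only on what the index determines. *)

Lemma fst_pair_code x y : (Cantor.of_nat (pair_code x y)).1 = x.
Proof. by rewrite Cantor.cancel_of_to. Qed.

Lemma snd_pair_code x y : (Cantor.of_nat (pair_code x y)).2 = y.
Proof. by rewrite Cantor.cancel_of_to. Qed.

Definition pair_codeE := (fst_pair_code, snd_pair_code).

Lemma pair_code_inj x y x' y' :
  pair_code x y = pair_code x' y' -> x = x' /\ y = y'.
Proof. by move=> /Cantor.to_nat_inj[-> ->]. Qed.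

Lemma pair_code_surj n : n = pair_code (Cantor.of_nat n).1 (Cantor.of_nat n).2.
Proof. by rewrite /pair_code -surjective_pairing Cantor.cancel_to_of. Qed.

Lemma le_pair_code x y : y + x <= pair_code x y.
Proof. exact/ssrnat.leP/Cantor.to_nat_non_decreasing. Qed.

Opaque pair_code.

Lemma prog_code_inj : injective prog_code.
Proof.
elim=> [||||| p IHp q IHq | p IHp q IHq | p IHp q IHq | p IHp];
  case=> [||||| p' q' | p' q' | p' q' | p'] //= /pair_code_inj[] //.
- by move=> _ /pair_code_inj[/IHp-> /IHq->].
- by move=> _ /pair_code_inj[/IHp-> /IHq->].
- by move=> _ /pair_code_inj[/IHp-> /IHq->].
- by move=> _ /IHp->.
Qed.

Lemma phi_relE A p x y : phi_rel A (prog_code p) x y <-> sem A p x y.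
Proof.
by split=> [[p' [/prog_code_inj->]]|?] //; exists p.
Qed.

Lemma sem_fun A p x y y' : sem A p x y -> sem A p x y' -> y = y'.
Proof.
elim: p x y y' => /= [|||||f IHf g IHg|f IHf g IHg|f IHf g IHg|f IHf] x y y'.
- by move=> -> ->.
- by move=> -> ->.
- by move=> -> ->.
- by move=> -> ->.
- by move=> [[? ->]|[? ->]] [[? ->]|[? ->]].
- move=> [u [v [fu gv ->]]] [u' [v' [fu' gv' ->]]].
  by rewrite (IHf _ _ _ fu fu') (IHg _ _ _ gv gv').
- move=> [u [gu fu]] [u' [gu' fu']].
  by rewrite (IHg _ _ _ gu gu') in fu; exact: IHf fu fu'.
- elim: (Cantor.of_nat x).2 y y' => [|n IHn] y y'; first exact: IHf.
  move=> [z [fz gz]] [z' [fz' gz']].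
  by rewrite (IHn _ _ fz fz') in gz; exact: IHg gz gz'.
- move=> [fy yle] [fy' y'le]; case: (ltngtP y y') => // [/y'le|/yle] [v fv].
  + by have := IHf _ _ _ fy fv.
  + by have := IHf _ _ _ fy' fv.
Qed.

(** * Computability relative to a class of oracles *)

(** A bijection rather than an injection: every number decodes, so an unbounded search over numbers
    is a search over [T], and no predicate has to test whether its argument is a code. *)
Class coded (T : Type) := Coded { enc : T -> nat; enc_bij : bijective enc }.

Lemma enc_inj {T} {cT : coded T} : injective (@enc T cT).
Proof. exact: bij_inj enc_bij. Qed.

Lemma enc_surj {T} {cT : coded T} n : exists x : T, enc x = n.
Proof. by have [g _ gK] := @enc_bij T cT; exists (g n). Qed.

#[global] Instance coded_nat : coded nat.
Proof. by exists id; exists id. Defined.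

Lemma enc_pair_bij {T T'} {cT : coded T} {cT' : coded T'} :
  bijective (fun z : T * T' => pair_code (enc z.1) (enc z.2)).
Proof.
have [f fK Kf] := @enc_bij T cT; have [g gK Kg] := @enc_bij T' cT'.
exists (fun n => (f (Cantor.of_nat n).1, g (Cantor.of_nat n).2)) => [[x y]|n] /=.
- by rewrite !pair_codeE fK gK.
- by rewrite Kf Kg -pair_code_surj.
Qed.

#[global] Instance coded_pair {T T'} {cT : coded T} {cT' : coded T'} :
  coded (T * T') := Coded enc_pair_bij.

Lemma seq_code_map_bij {T} {cT : coded T} :
  bijective (fun s : seq T => seq_code [seq enc x | x <- s]).
Proof.
have [g gK Kg] := @enc_bij T cT.
have inj : injective (fun s : seq T => seq_code [seq enc x | x <- s]).
  elim=> [|x s IHs] [|x' s'] //= [] /pair_code_inj[xx' ss'].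
  by rewrite (enc_inj xx') (IHs _ ss').
have surj n : exists s : seq T, seq_code [seq enc x | x <- s] = n.
  elim/ltn_ind: n => -[|n] IHn; first by exists [::].
  have lt_n : (Cantor.of_nat n).2 < n.+1.
    rewrite ltnS [leqRHS]pair_code_surj (leq_trans _ (le_pair_code _ _)) //.
    exact: leq_addr.
  have [s sE] := IHn _ lt_n.
  exists (g (Cantor.of_nat n).1 :: s) => /=.
  by rewrite sE Kg -pair_code_surj.
have [h hP] := choice surj.
exists h => [s|n]; last exact: hP.
by apply: inj; rewrite hP.
Qed.

#[global] Instance coded_seq {T} {cT : coded T} : coded (seq T) :=
  Coded seq_code_map_bij.

Lemma enc_pairE {T T'} {cT : coded T} {cT' : coded T'} (x : T) (y : T') :
  enc (x, y) = pair_code (enc x) (enc y).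
Proof. by []. Qed.

Lemma enc_seq_nat (s : seq nat) : enc s = seq_code s.
Proof. by rewrite /enc /= map_id. Qed.

(** One program serves all oracles in [S], and [F] may depend on the oracle. The case [S = setT] is
    the uniformity needed for splicing programs; a singleton gives computability relative to a fixed
    set. *)
Definition recursive (S : set (set nat)) {T T'} {cT : coded T} {cT' : coded T'}
    (F : set nat -> T -> T') : Prop :=
  exists p, forall A, S A -> forall x, sem A p (enc x) (enc (F A x)).

Section Recursive.
Context {S : set (set nat)}.

Lemma rec_ext {T T'} {cT : coded T} {cT' : coded T'} (F G : set nat -> T -> T') :
  (forall A x, F A x = G A x) -> recursive S F -> recursive S G.
Proof. by move=> FG [p pP]; exists p => A SA x; rewrite -FG; exact: pP. Qed.

Lemma rec_fst {T T1 T2} {cT : coded T} {c1 : coded T1} {c2 : coded T2}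
    (F : set nat -> T -> T1 * T2) :
  recursive S F -> recursive S (fun A x => (F A x).1).
Proof.
move=> [p pP]; exists (PComp PFst p) => A SA x.
by exists (enc (F A x)); split; [exact: pP | rewrite /= pair_codeE].
Qed.

Lemma rec_snd {T T1 T2} {cT : coded T} {c1 : coded T1} {c2 : coded T2}
    (F : set nat -> T -> T1 * T2) :
  recursive S F -> recursive S (fun A x => (F A x).2).
Proof.
move=> [p pP]; exists (PComp PSnd p) => A SA x.
by exists (enc (F A x)); split; [exact: pP | rewrite /= pair_codeE].
Qed.

Lemma rec_pair {T T1 T2} {cT : coded T} {c1 : coded T1} {c2 : coded T2}
    (F : set nat -> T -> T1) (G : set nat -> T -> T2) :
  recursive S F -> recursive S G -> recursive S (fun A x => (F A x, G A x)).
Proof.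
move=> [p pP] [r rP]; exists (PPair p r) => A SA x.
by exists (enc (F A x)), (enc (G A x)); split; [exact: pP | exact: rP |].
Qed.

Lemma rec_id {T} {cT : coded T} : recursive S (fun _ (x : T) => x).
Proof.
(* There is no basic identity program: a number is rebuilt from its two components. *)
exists (PPair PFst PSnd) => A _ x /=.
by do 2 eexists; split=> //; rewrite -pair_code_surj.
Qed.

Lemma rec_comp {T1 T2 T3} {c1 : coded T1} {c2 : coded T2} {c3 : coded T3}
    (G : set nat -> T2 -> T3) (F : set nat -> T1 -> T2) :
  recursive S G -> recursive S F -> recursive S (fun A x => G A (F A x)).
Proof.
move=> [r rP] [p pP]; exists (PComp r p) => A SA x.
by exists (enc (F A x)); split; [exact: pP | exact: rP].
Qed.

Definition pconst (m : nat) : prog := iter m (PComp PSucc) PZero.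

Lemma sem_pconst A m x : sem A (pconst m) x m.
Proof. by elim: m => //= m IHm; exists m. Qed.

Lemma rec_const {T T'} {cT : coded T} {cT' : coded T'} (y : T') :
  recursive S (fun _ (_ : T) => y).
Proof. by exists (pconst (enc y)) => A _ x; exact: sem_pconst. Qed.

Lemma rec_succ {T} {cT : coded T} (F : set nat -> T -> nat) :
  recursive S F -> recursive S (fun A x => (F A x).+1).
Proof.
by move=> [p pP]; exists (PComp PSucc p) => A SA x; exists (F A x); split=> //;
  exact: pP.
Qed.

Lemma rec_pair_code {T} {cT : coded T} (F G : set nat -> T -> nat) :
  recursive S F -> recursive S G ->
  recursive S (fun A x => pair_code (F A x) (G A x)).
Proof. exact: rec_pair. Qed.

(** Only codes matter to a program, so the same program serves when the value is read in another
    type with the same code. *)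
Lemma rec_recode {T T1 T2} {cT : coded T} {c1 : coded T1} {c2 : coded T2}
    (F : set nat -> T -> T1) (G : set nat -> T -> T2) :
  (forall A x, enc (F A x) = enc (G A x)) -> recursive S F -> recursive S G.
Proof. by move=> FG [p pP]; exists p => A SA x; rewrite -FG; exact: pP. Qed.

Lemma rec_enc {T T'} {cT : coded T} {cT' : coded T'} (F : set nat -> T -> T') :
  recursive S F -> recursive S (fun A x => enc (F A x)).
Proof. exact: rec_recode. Qed.

Lemma rec_nat_rect {T T'} {cT : coded T} {cT' : coded T'}
    (F : set nat -> T -> T') (G : set nat -> T * (nat * T') -> T')
    (N : set nat -> T -> nat) :
  recursive S F -> recursive S G -> recursive S N ->
  recursive S (fun A x =>
    nat_rect (fun=> T') (F A x) (fun n z => G A (x, (n, z))) (N A x)).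
Proof.
move=> [p pP] [r rP] [n nP].
have [i iP] := @rec_id T cT.
exists (PComp (PPrec p r) (PPair i n)) => A SA x.
exists (pair_code (enc x) (N A x)); split.
  by exists (enc x), (N A x); split; [exact: iP | exact: nP |].
rewrite /= !pair_codeE; elim: (N A x) => [|m IHm]; first exact: pP.
by eexists; split; [exact: IHm | exact: (rP A SA (x, (m, _)))].
Qed.

Lemma rec_iter {T T'} {cT : coded T} {cT' : coded T'}
    (G : set nat -> T * T' -> T') (F : set nat -> T -> T')
    (N : set nat -> T -> nat) :
  recursive S G -> recursive S F -> recursive S N ->
  recursive S (fun A x => iter (N A x) (fun z => G A (x, z)) (F A x)).
Proof.
move=> rG rF rN.
have : recursive S (fun A (x : T * (nat * T')) => G A (x.1, x.2.2)).
  apply: rec_comp => //; apply: rec_pair; first by apply: rec_fst; apply: rec_id.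
  by do 2 apply: rec_snd; apply: rec_id.
move=> /(rec_nat_rect rF) /(_ rN); apply: rec_ext => A x /=.
by elim: (N A x) => //= n ->.
Qed.

Lemma rec_pred {T} {cT : coded T} (F : set nat -> T -> nat) :
  recursive S F -> recursive S (fun A x => (F A x).-1).
Proof.
move=> rF.
have rG : recursive S (fun _ (z : T * (nat * nat)) => z.2.1).
  by apply: rec_fst; apply: rec_snd; apply: rec_id.
have := rec_nat_rect (rec_const 0) rG rF.
by apply: rec_ext => A x; case: (F A x).
Qed.

Lemma rec_add {T} {cT : coded T} (F G : set nat -> T -> nat) :
  recursive S F -> recursive S G -> recursive S (fun A x => F A x + G A x).
Proof.
move=> rF rG.
have r1 : recursive S (fun _ (z : T * nat) => z.2.+1).
  by apply: rec_succ; apply: rec_snd; apply: rec_id.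
have := rec_iter r1 rF rG.
by apply: rec_ext => A x; rewrite iter_succn.
Qed.

Lemma rec_sub {T} {cT : coded T} (F G : set nat -> T -> nat) :
  recursive S F -> recursive S G -> recursive S (fun A x => F A x - G A x).
Proof.
move=> rF rG.
have r1 : recursive S (fun _ (z : T * nat) => z.2.-1).
  by apply: rec_pred; apply: rec_snd; apply: rec_id.
have := rec_iter r1 rF rG.
by apply: rec_ext => A x; rewrite iter_predn.
Qed.

Lemma rec_mul {T} {cT : coded T} (F G : set nat -> T -> nat) :
  recursive S F -> recursive S G -> recursive S (fun A x => F A x * G A x).
Proof.
move=> rF rG.
have rF' : recursive S (fun A (z : T * nat) => F A z.1 + z.2).
  apply: rec_add; last by apply: rec_snd; apply: rec_id.
  by apply: rec_comp => //; apply: rec_fst; apply: rec_id.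
have := rec_iter rF' (rec_const 0) rG.
apply: rec_ext => A x.
by elim: (G A x) => [|n /= ->]; rewrite ?muln0 ?mulnS.
Qed.

End Recursive.

Definition decidable_in (S : set (set nat)) {T} {cT : coded T}
    (P : set nat -> T -> Prop) : Prop :=
  recursive S (fun A x => nat_of_bool `[<P A x>]).

Section Decidable.
Context {S : set (set nat)} {T : Type} {cT : coded T}.
Implicit Types P Q : set nat -> T -> Prop.

Lemma dec_ext P Q :
  (forall A x, P A x <-> Q A x) -> decidable_in S P -> decidable_in S Q.
Proof.
move=> PQ; apply: rec_ext => A x; congr nat_of_bool.
by apply/asboolP/asboolP => /PQ.
Qed.

Lemma dec_not P : decidable_in S P -> decidable_in S (fun A x => ~ P A x).
Proof.
move=> /(rec_sub (rec_const 1)); apply: rec_ext => A x.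
by rewrite asbool_neg; case: `[<P A x>].
Qed.

Lemma dec_and P Q : decidable_in S P -> decidable_in S Q ->
  decidable_in S (fun A x => P A x /\ Q A x).
Proof.
move=> rP rQ; have := rec_mul rP rQ; apply: rec_ext => A x.
by rewrite asbool_and mulnb.
Qed.

Lemma dec_or P Q : decidable_in S P -> decidable_in S Q ->
  decidable_in S (fun A x => P A x \/ Q A x).
Proof.
move=> /dec_not rP /dec_not rQ; have := dec_not (dec_and rP rQ).
apply: dec_ext => A x; split=> [/not_andP[]/contrapT|[?|?] []] //;
  by [left | right].
Qed.

Lemma dec_leq (F G : set nat -> T -> nat) :
  recursive S F -> recursive S G -> decidable_in S (fun A x => F A x <= G A x).
Proof.
move=> rF rG; have := rec_sub (rec_const 1) (rec_sub rF rG).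
apply: rec_ext => A x; rewrite asboolb -subn_eq0.
by case: (F A x - G A x).
Qed.

Lemma dec_oracle (F : set nat -> T -> nat) :
  recursive S F -> decidable_in S (fun A x => A (F A x)).
Proof.
move=> [p pP]; exists (PComp POracle p) => A SA x; exists (F A x).
split; first exact: pP.
by rewrite /=; case: (asboolP (A (F A x))) => ?; [left | right].
Qed.

End Decidable.

Lemma dec_eq {S T T'} {cT : coded T} {cT' : coded T'} (F G : set nat -> T -> T') :
  recursive S F -> recursive S G -> decidable_in S (fun A x => F A x = G A x).
Proof.
move=> /rec_enc rF /rec_enc rG.
have := dec_and (dec_leq rF rG) (dec_leq rG rF).
apply: dec_ext => A x; split=> [[le1 le2]|->//].
by apply: enc_inj; apply/eqP; rewrite eqn_leq le1.
Qed.

(** * The jump *)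

(** A reduction between oracles is composed with a computation in the text of the program, so that
    its effect on codes can itself be computed. *)
Fixpoint oracle_subst (r p : prog) : prog :=
  match p with
  | POracle => r
  | PPair f g => PPair (oracle_subst r f) (oracle_subst r g)
  | PComp f g => PComp (oracle_subst r f) (oracle_subst r g)
  | PPrec f g => PPrec (oracle_subst r f) (oracle_subst r g)
  | PMu f => PMu (oracle_subst r f)
  | _ => p
  end.

Lemma sem_oracle_subst A B r p x y :
  (forall x, sem B r x `[<A x>]) ->
  sem B (oracle_subst r p) x y <-> sem A p x y.
Proof.
move=> rP.
elim: p x y => /= [|||||f IHf g IHg|f IHf g IHg|f IHf g IHg|f IHf] x y //.
- split=> [/(sem_fun (rP x))<-|].
    by case: asboolP => ?; [left|right].
  by move: (rP x); case: asboolP => ? ? [[]|[]] // _ ->.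
- by split=> -[u [v [/IHf fu /IHg gv yE]]]; exists u, v.
- by split=> -[u [/IHg gu /IHf fu]]; exists u.
- elim: (Cantor.of_nat x).2 y => [|n IHn] y; first exact: IHf.
  by split=> -[z [/IHn fz /IHg gz]]; exists z.
- split=> -[/IHf fy yle]; split=> // m /yle[v /IHf fv]; by exists v.
Qed.

Lemma rec_oracle_subst {T T'} {cT : coded T} {cT' : coded T'} A B (f : T -> T') :
  decidable_in [set B] (fun=> A) ->
  recursive [set A] (fun=> f) -> recursive [set B] (fun=> f).
Proof.
move=> [r rP] [p pP]; exists (oracle_subst r p) => _ -> x.
by apply/(sem_oracle_subst (A := A)) => [n|]; [exact: rP | exact: pP].
Qed.

(** The program ignores its input and searches with parameter [x]. Hence the diagonal halting
    question that [jump] asks at this code is whether the search from [x] ends. *)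
Definition search_code (p : prog) (x : nat) : nat :=
  prog_code (PComp (PMu p) (pconst x)).

Lemma rec_pconst_code {S T} {cT : coded T} (F : set nat -> T -> nat) :
  recursive S F -> recursive S (fun A x => prog_code (pconst (F A x))).
Proof.
move=> rF.
have rG : recursive S (fun _ (z : T * nat) =>
    pair_code 6 (pair_code (prog_code PSucc) z.2)).
  by do 2 apply: rec_pair_code (rec_const _) _; apply: rec_snd; apply: rec_id.
have := rec_iter rG (rec_const (prog_code PZero)) rF.
by apply: rec_ext => A x; elim: (F A x) => //= n ->.
Qed.

Lemma rec_search_code {S T} {cT : coded T} p (F : set nat -> T -> nat) :
  recursive S F -> recursive S (fun A x => search_code p (F A x)).
Proof.
move=> rF; do 2 apply: rec_pair_code (rec_const _) _.
exact: rec_pconst_code.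
Qed.

Lemma jump_search B p (z : nat -> nat -> nat) x :
  (forall t, sem B p (pair_code x t) (z x t)) ->
  jump B (search_code p x) <-> exists t, z x t = 0.
Proof.
move=> pP; split=> [[y /phi_relE /= [u [/sem_fun/(_ (sem_pconst _ _ _)) ->]]]|[t zt]].
  by move=> [py _]; exists y; exact: sem_fun (pP _) py.
have [y /eqP zy miny] : {y | z x y == 0 & forall m, z x m == 0 -> y <= m}.
  have ex : exists y, z x y == 0 by exists t; apply/eqP.
  by case: (ex_minnP ex) => y; exists y.
exists y; apply/phi_relE; exists x; split; first exact: sem_pconst.
split=> [|m lt_my]; first by rewrite -zy.
have := pP m; case zm: (z x m) => [|v]; last by exists v.
by have := miny m; rewrite zm leqNgt lt_my => /(_ (eqxx _)).
Qed.

Lemma dec_jump_ex {T T'} {cT : coded T} {cT' : coded T'} B (P : T -> T' -> Prop) :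
  decidable_in [set B] (fun _ z => P z.1 z.2) ->
  decidable_in [set jump B] (fun _ x => exists y, P x y).
Proof.
move=> /dec_not[p pP].
(* The answers of the decision procedure as a function on all numbers: the value is 0 exactly at the
   codes of a pair in [P], as a search for a zero requires. *)
pose z := fun x t : nat => nat_of_bool `[<~ exists (x' : T) (y' : T'),
  [/\ x = @enc T cT x', t = @enc T' cT' y' & P x' y']>].
have zP x t : sem B p (pair_code x t) (z x t).
  have [[x' <-] [y' <-]] := (enc_surj (T := T) x, enc_surj (T := T') t).
  have -> : z (enc x') (enc y') = `[<~ P x' y'>].
    congr nat_of_bool; apply/asboolP/asboolP => nP h; apply: nP.
      by exists x', y'.
    have [x1 [y1 [xx1 yy1 Pxy]]] := h.
    by rewrite (enc_inj xx1) (enc_inj yy1).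
  exact: (pP B erefl (x', y')).
have := dec_oracle (S := [set jump B])
  (rec_search_code p (rec_enc (rec_id (T := T)))).
move=> [r rP]; exists r => _ -> x; have := rP _ erefl x.
congr sem; congr (enc (nat_of_bool _)).
apply/asboolP/asboolP => [/(jump_search (zP _))[t]|[y Pxy]].
- rewrite /z; case: asboolP => //= /contrapT[x' [y' [xx' _ Pxy]]] _.
  by exists y'; rewrite (enc_inj xx').
- apply/(jump_search (zP _)); exists (enc y).
  by rewrite /z; case: asboolP => // -[]; exists x, y.
Qed.

(** [B] is its own image under a vacuous existential quantifier, which the jump decides. *)
Lemma dec_jump B : decidable_in [set jump B] (fun=> B).
Proof.
have : decidable_in [set B] (fun _ (z : nat * nat) => B z.1).
  by have := dec_oracle (S := [set B]) (rec_fst (rec_id (T := nat * nat)));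
    move=> [p pP]; exists p => _ -> x; exact: (pP _ erefl).
move=> /(dec_jump_ex (P := fun x _ => B x)); apply: dec_ext => _ x.
by split=> [[]|] //; exists 0.
Qed.

Lemma rec_jump {T T'} {cT : coded T} {cT' : coded T'} B (f : T -> T') :
  recursive [set B] (fun=> f) -> recursive [set jump B] (fun=> f).
Proof. exact: rec_oracle_subst (dec_jump B). Qed.

(** * Arithmetical functions and predicates *)

Definition arithf (A : set nat) {T T'} {cT : coded T} {cT' : coded T'}
    (f : T -> T') : Prop :=
  exists k, recursive [set iter k jump A] (fun=> f).

Definition arith (A : set nat) {T} {cT : coded T} (P : T -> Prop) : Prop :=
  exists k, decidable_in [set iter k jump A] (fun=> P).

Section Arith.
Context {A : set nat}.

Lemma rec_jumpW {T T'} {cT : coded T} {cT' : coded T'} k k' (f : T -> T') :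
  k <= k' -> recursive [set iter k jump A] (fun=> f) ->
  recursive [set iter k' jump A] (fun=> f).
Proof.
move=> /subnK <-; elim: (k' - k) => // n IHn /IHn.
exact: rec_jump.
Qed.

Lemma recursive_arithf {T T'} {cT : coded T} {cT' : coded T'} (f : T -> T') :
  recursive setT (fun=> f) -> arithf A f.
Proof. by move=> [p pP]; exists 0, p => ? _; exact: pP. Qed.

Lemma arithf_comp {T1 T2 T3} {c1 : coded T1} {c2 : coded T2} {c3 : coded T3}
    (g : T2 -> T3) (f : T1 -> T2) :
  arithf A g -> arithf A f -> arithf A (fun x => g (f x)).
Proof.
move=> [k /(rec_jumpW (leq_maxl k _)) rg] [k' /(rec_jumpW (leq_maxr _ _)) rf].
by exists (maxn k k'); apply: rec_comp (rg _) (rf _).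
Qed.

Lemma arithf_pair {T T1 T2} {cT : coded T} {c1 : coded T1} {c2 : coded T2}
    (f : T -> T1) (g : T -> T2) :
  arithf A f -> arithf A g -> arithf A (fun x => (f x, g x)).
Proof.
move=> [k /(rec_jumpW (leq_maxl k _)) rf] [k' /(rec_jumpW (leq_maxr _ _)) rg].
by exists (maxn k k'); apply: rec_pair (rf _) (rg _).
Qed.

Lemma arithf_id {T} {cT : coded T} : arithf A (fun x : T => x).
Proof. by apply: recursive_arithf; apply: rec_id. Qed.

Lemma arithf_const {T T'} {cT : coded T} {cT' : coded T'} (y : T') :
  arithf A (fun _ : T => y).
Proof. by apply: recursive_arithf; apply: rec_const. Qed.

Lemma arithf_fst {T T1 T2} {cT : coded T} {c1 : coded T1} {c2 : coded T2}
    (f : T -> T1 * T2) : arithf A f -> arithf A (fun x => (f x).1).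
Proof.
apply: arithf_comp; apply: recursive_arithf; apply: rec_fst; apply: rec_id.
Qed.

Lemma arithf_snd {T T1 T2} {cT : coded T} {c1 : coded T1} {c2 : coded T2}
    (f : T -> T1 * T2) : arithf A f -> arithf A (fun x => (f x).2).
Proof.
apply: arithf_comp; apply: recursive_arithf; apply: rec_snd; apply: rec_id.
Qed.

Lemma arithf_rec2 {T T1 T2 T3} {cT : coded T} {c1 : coded T1} {c2 : coded T2}
    {c3 : coded T3} (h : T1 -> T2 -> T3) (f : T -> T1) (g : T -> T2) :
  recursive setT (fun _ z => h z.1 z.2) ->
  arithf A f -> arithf A g -> arithf A (fun x => h (f x) (g x)).
Proof.
move=> /recursive_arithf rh rf rg.
exact: (arithf_comp rh (arithf_pair rf rg)).
Qed.

Lemma arith_ext {T} {cT : coded T} (P Q : T -> Prop) :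
  (forall x, P x <-> Q x) -> arith A P -> arith A Q.
Proof. by move=> PQ [k rP]; exists k; apply: dec_ext rP. Qed.

Lemma arith_comp {T T'} {cT : coded T} {cT' : coded T'} (P : T' -> Prop)
    (f : T -> T') : arith A P -> arithf A f -> arith A (fun x => P (f x)).
Proof.
move=> [k rP] rf; have [k' r] := arithf_comp (ex_intro _ k rP) rf.
by exists k'.
Qed.

Lemma arith_not {T} {cT : coded T} (P : T -> Prop) :
  arith A P -> arith A (fun x => ~ P x).
Proof. by move=> [k rP]; exists k; apply: dec_not. Qed.

Lemma arith_and {T} {cT : coded T} (P Q : T -> Prop) :
  arith A P -> arith A Q -> arith A (fun x => P x /\ Q x).
Proof.
move=> [k /(rec_jumpW (leq_maxl k _)) rP] [k' /(rec_jumpW (leq_maxr _ _)) rQ].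
by exists (maxn k k'); apply: dec_and (rP _) (rQ _).
Qed.

Lemma arith_or {T} {cT : coded T} (P Q : T -> Prop) :
  arith A P -> arith A Q -> arith A (fun x => P x \/ Q x).
Proof.
move=> /arith_not rP /arith_not rQ; have := arith_not (arith_and rP rQ).
by apply: arith_ext => x; split=> [/not_andP[]/contrapT|[?|?] []] //;
  [left | right].
Qed.

Lemma arith_imp {T} {cT : coded T} (P Q : T -> Prop) :
  arith A P -> arith A Q -> arith A (fun x => P x -> Q x).
Proof.
move=> rP /arith_not rQ; have := arith_not (arith_and rP rQ).
apply: arith_ext => x; split=> [h Px|PQ [/PQ]] //.
by apply: contrapT => nQ; apply: h.
Qed.

Lemma arith_iff {T} {cT : coded T} (P Q : T -> Prop) :
  arith A P -> arith A Q -> arith A (fun x => P x <-> Q x).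
Proof. by move=> rP rQ; apply: arith_and; apply: arith_imp. Qed.

Lemma arith_ex {T T'} {cT : coded T} {cT' : coded T'} (P : T -> T' -> Prop) :
  arith A (fun z => P z.1 z.2) -> arith A (fun x => exists y, P x y).
Proof. by move=> [k rP]; exists k.+1; apply: dec_jump_ex. Qed.

Lemma arith_all {T T'} {cT : coded T} {cT' : coded T'} (P : T -> T' -> Prop) :
  arith A (fun z => P z.1 z.2) -> arith A (fun x => forall y, P x y).
Proof.
move=> /arith_not/(arith_ex (P := fun x y => ~ P x y))/arith_not.
apply: arith_ext => x; split=> [h y|h [y]] //.
by apply: contrapT => nP; apply: h; exists y.
Qed.

Lemma arith_eq {T T'} {cT : coded T} {cT' : coded T'} (f g : T -> T') :
  arithf A f -> arithf A g -> arith A (fun x => f x = g x).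
Proof.
move=> rf rg.
apply: (arith_comp (P := fun z => z.1 = z.2) _ (arithf_pair rf rg)).
exists 0; apply: dec_eq; [apply: rec_fst | apply: rec_snd]; exact: rec_id.
Qed.

Lemma arith_leq {T} {cT : coded T} (f g : T -> nat) :
  arithf A f -> arithf A g -> arith A (fun x => f x <= g x).
Proof.
move=> rf rg.
apply: (arith_comp (P := fun z => z.1 <= z.2) _ (arithf_pair rf rg)).
exists 0; apply: dec_leq; [apply: rec_fst | apply: rec_snd]; exact: rec_id.
Qed.

Lemma arithf_enc {T T'} {cT : coded T} {cT' : coded T'} (f : T -> T') :
  arithf A f -> arithf A (fun x => enc (f x)).
Proof. by move=> [k rf]; exists k; apply: rec_enc. Qed.

Lemma arithf_succ {T} {cT : coded T} (f : T -> nat) :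
  arithf A f -> arithf A (fun x => (f x).+1).
Proof. by move=> [k rf]; exists k; apply: rec_succ. Qed.

Lemma arithf_pred {T} {cT : coded T} (f : T -> nat) :
  arithf A f -> arithf A (fun x => (f x).-1).
Proof. by move=> [k rf]; exists k; apply: rec_pred. Qed.

Lemma arithf_add {T} {cT : coded T} (f g : T -> nat) :
  arithf A f -> arithf A g -> arithf A (fun x => f x + g x).
Proof.
by apply: arithf_rec2; apply: rec_add; [apply: rec_fst|apply: rec_snd];
  exact: rec_id.
Qed.

Lemma arithf_sub {T} {cT : coded T} (f g : T -> nat) :
  arithf A f -> arithf A g -> arithf A (fun x => f x - g x).
Proof.
by apply: arithf_rec2; apply: rec_sub; [apply: rec_fst|apply: rec_snd];
  exact: rec_id.
Qed.

Lemma arithf_mul {T} {cT : coded T} (f g : T -> nat) :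
  arithf A f -> arithf A g -> arithf A (fun x => f x * g x).
Proof.
by apply: arithf_rec2; apply: rec_mul; [apply: rec_fst|apply: rec_snd];
  exact: rec_id.
Qed.

Lemma arithf_pair_code {T} {cT : coded T} (f g : T -> nat) :
  arithf A f -> arithf A g -> arithf A (fun x => pair_code (f x) (g x)).
Proof.
by apply: arithf_rec2; apply: rec_pair_code; [apply: rec_fst|apply: rec_snd];
  exact: rec_id.
Qed.

(** The value is found by searching through the graph. A function can thus be shown arithmetical by
    describing its value with quantifiers, without programming it. *)
Lemma arithf_graph {T T'} {cT : coded T} {cT' : coded T'} (f : T -> T') :
  arith A (fun z => z.2 = f z.1) -> arithf A f.
Proof.
move=> [k /dec_not[p pP]]; exists k, (PMu p) => _ -> x.
have zP y : sem (iter k jump A) p (pair_code (enc x) (enc y)) `[<~ (y = f x)>].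
  exact: (pP _ erefl (x, y)).
split; first by have := zP (f x); case: asboolP.
move=> m lt_m; have [y yE] := enc_surj (T := T') m.
have := zP y; rewrite yE; case: asboolP => [|/contrapT yfx]; first by exists 0.
by rewrite -yE yfx ltnn in lt_m.
Qed.

End Arith.

(** * The sum of the finite jumps of the empty set *)

(** The components are in the order used by [Hset_lim], so that this is literally the H-set at the
    notation of omega constructed below. *)
Definition jump_omega : set nat :=
  [set z | iter (Cantor.of_nat z).2 jump set0 (Cantor.of_nat z).1].

Lemma jump_omegaE x k : jump_omega (pair_code x k) <-> iter k jump set0 x.
Proof. by rewrite /jump_omega /= !pair_codeE. Qed.

Lemma dec_iter_jump k : decidable_in [set jump_omega] (fun=> iter k jump set0).
Proof.
have := dec_oracle (S := [set jump_omega])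
  (rec_pair_code (rec_id (T := nat)) (rec_const k)).
move=> [p pP]; exists p => _ -> x; have := pP _ erefl x.
by rewrite (asbool_equiv_eq (jump_omegaE _ _)).
Qed.

Lemma arith_jump_omega {T} {cT : coded T} (P : T -> Prop) :
  arith set0 P -> arith jump_omega P.
Proof. by move=> [k rf]; exists 0; apply: rec_oracle_subst rf; apply: dec_iter_jump. Qed.

(** As [p] is fixed and only [r] varies, the recursion on [p] takes place outside the programs: no
    program acting on codes of arbitrary programs is needed. *)
Lemma oracle_subst_code S p : exists2 h : nat -> nat,
  recursive S (fun=> h) & forall r, prog_code (oracle_subst r p) = h (prog_code r).
Proof.
have one c (f : prog) (h : nat -> nat) : recursive S (fun=> h) ->
    recursive S (fun _ n => pair_code c (h n)).
  by move=> rh; apply: rec_pair_code => //; exact: rec_const.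
have two c (h h' : nat -> nat) : recursive S (fun=> h) ->
    recursive S (fun=> h') ->
    recursive S (fun _ n => pair_code c (pair_code (h n) (h' n))).
  move=> rh rh'; apply: rec_pair_code; first exact: rec_const.
  exact: rec_pair_code.
elim: p => [|||||f [h rh hE] g [h' rh' hE']|f [h rh hE] g [h' rh' hE']
  |f [h rh hE] g [h' rh' hE']|f [h rh hE]].
- by eexists; first exact: (rec_const (prog_code PZero)).
- by eexists; first exact: (rec_const (prog_code PSucc)).
- by eexists; first exact: (rec_const (prog_code PFst)).
- by eexists; first exact: (rec_const (prog_code PSnd)).
- by exists id; first exact: rec_id.
- by eexists; [exact: (two 5 _ _ rh rh') | move=> r /=; rewrite hE hE'].
- by eexists; [exact: (two 6 _ _ rh rh') | move=> r /=; rewrite hE hE'].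
- by eexists; [exact: (two 7 _ _ rh rh') | move=> r /=; rewrite hE hE'].
- by eexists; [exact: (one 8 f _ rh) | move=> r /=; rewrite hE].
Qed.

(* If [X k.+1] is obtained from [X k] by an existential quantifier applied to a
   decision procedure with oracle [X k], then membership in [X k] many-one
   reduces to the k-th jump of [X 0]. The reductions are obtained by splicing
   the program of the k-th one into that procedure, so their codes are
   computable uniformly in k. *)
Section UniformJumps.
Context {T T' : Type} {cT : coded T} {cT' : coded T'}.
Variables (X : nat -> T -> Prop) (B : set nat -> T * T' -> Prop).
Hypothesis X0 : arith set0 (X 0).
Hypothesis decB : decidable_in setT B.
Hypothesis XS : forall k x,
  X k.+1 x <-> exists t, B [set enc y | y in X k] (x, t).

Let XsetE k (x : T) : [set enc y | y in X k] (enc x) <-> X k x.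
Proof. by split=> [[y Xy yx]|Xx]; [rewrite -(enc_inj yx) | exists x]. Qed.

Lemma arith_uniform_jumps : arith jump_omega (fun z : nat * T => X z.1 z.2).
Proof.
have [m [p0 p0P]] := X0.
have [pB pBP] := dec_not decB.
(* [cc] is a program that outputs the code of a constant program. It becomes part of the reductions,
   which must compute codes at run time. *)
have [cc ccP] : exists cc, forall A x, sem A cc x (prog_code (pconst x)).
  have [cc ccP] := rec_pconst_code (S := setT) (rec_id (T := nat)).
  by exists cc => A x; exact: ccP.
have [neg negP] := rec_sub (S := setT) (rec_const 1) (rec_id (T := nat)).
(* The tag 6 is that of [PComp]: on input [x] the output is the code of
   [PComp (PMu Z) (pconst x)]. *)
pose reduction Z := PPair (pconst 6)
  (PPair (pconst (prog_code (PMu Z))) cc).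
have sem_reduction A Z x : sem A (reduction Z) x (search_code Z x).
  exists 6, (pair_code (prog_code (PMu Z)) (prog_code (pconst x))).
  split; [exact: sem_pconst | | by []].
  exists (prog_code (PMu Z)), (prog_code (pconst x)).
  by split; [exact: sem_pconst | exact: ccP |].
(* [Z k] is meant for the oracle that is the jump of order [m + k]: on a pair [x], [t] it answers 0
   when [t] witnesses [X k x], so [X k x] is a halting question, answered by the next jump. For
   [k = 0] the witness is ignored. For [k.+1] each oracle question of [pB] about [X k] is replaced
   by the halting question for [Z k]. *)
pose Z := nat_rect (fun=> prog) (PComp neg (PComp p0 PFst))
  (fun _ Z => oracle_subst (PComp POracle (reduction Z)) pB).
have X_search k x :
    iter (m + k).+1 jump set0 (search_code (Z k) (enc x)) <-> X k x.
  elim: k x => [|k IHk] x.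
    rewrite addn0 iterS.
    have zP t : sem (iter m jump set0) (Z 0) (pair_code (enc x) t)
        (1 - `[<X 0 x>]).
      exists `[<X 0 x>]; split; last exact: negP.
      exists (enc x); split; first by rewrite /= pair_codeE.
      exact: p0P.
    rewrite (jump_search (z := fun _ _ => 1 - `[<X 0 x>])) //.
    by case: asboolP => Xx; split=> [[t //]|//] _; exists 0.
  rewrite addnS iterS.
  set J := iter (m + k).+1 jump set0 in IHk *.
  pose r := PComp POracle (reduction (Z k)).
  have rP n : sem J r n `[<[set enc y | y in X k] n>].
    exists (search_code (Z k) n); split; first exact: sem_reduction.
    have [y <-] := enc_surj (T := T) n.
    case: asboolP => /XsetE Xy; [left | right]; split=> //; first exact/IHk.
    by move/IHk.
  pose z (_ n : nat) := nat_of_bool `[<forall t : T', @enc T' cT' t = n ->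
    ~ B [set @enc T cT y | y in X k] (x, t)>].
  rewrite (jump_search (z := z)) => [|n].
    rewrite XS; split=> [[n]|[t Bt]].
      rewrite /z; case: asboolP => // /existsNP[t /not_implyP[_ /contrapT Bt]] _.
      by exists t.
    exists (enc t); rewrite /z; case: asboolP => // /(_ t erefl) //.
  apply/(sem_oracle_subst _ _ _ rP).
  have [t <-] := enc_surj (T := T') n.
  rewrite [z _ _](_ : _ = nat_of_bool
    `[<~ B [set enc y | y in X k] (x, t)>]).
    exact: (pBP _ I (x, t)).
  congr nat_of_bool.
  apply/asboolP/asboolP => [/(_ t erefl)//|nB t' tt'].
  by rewrite (enc_inj tt').
have [h rh hE] := oracle_subst_code [set jump_omega] pB.
have rZ : recursive [set jump_omega] (fun _ (z : nat * T) => prog_code (Z z.1)).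
  (* The argument of [h] is the code of [PComp POracle (reduction Z)] written as a function of the
     code [u.2] of [Z]; the tag 8 is that of [PMu]. *)
  have rG : recursive [set jump_omega] (fun _ (u : (nat * T) * nat) =>
      h (pair_code 6 (pair_code (prog_code POracle)
        (pair_code 5 (pair_code (prog_code (pconst 6))
          (pair_code 5 (pair_code (prog_code (pconst (pair_code 8 u.2)))
            (prog_code cc)))))))).
    apply: (rec_comp rh).
    do 5 apply: rec_pair_code (rec_const _) _.
    apply: rec_pair_code; last exact: rec_const.
    apply: rec_pconst_code; apply: rec_pair_code; first exact: rec_const.
    by apply: rec_snd; apply: rec_id.
  have := rec_iter rG (rec_const (prog_code (Z 0))) (rec_fst rec_id).
  apply: rec_ext => A [k x] /=; elim: k => // k.
  by rewrite [iter _.+1 _ _]/= => ->; rewrite hE.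
have rS : recursive [set jump_omega] (fun _ (z : nat * T) =>
    pair_code (search_code (Z z.1) (enc z.2)) (m + z.1).+1).
  have r1 : recursive [set jump_omega] (fun _ (z : nat * T) => z.1).
    by apply: rec_fst; apply: rec_id.
  apply: rec_pair_code; last by apply: rec_succ; apply: rec_add => //; exact: rec_const.
  apply: rec_pair_code; first exact: rec_const.
  apply: rec_pair_code.
    by apply: rec_pair_code => //; exact: rec_const.
  by apply: rec_pconst_code; apply: rec_enc; apply: rec_snd; apply: rec_id.
exists 0; have [p pP] := dec_oracle rS; exists p => _ -> z.
have := pP _ erefl z; congr sem; congr (enc (nat_of_bool _)).
have := X_search z.1 z.2; rewrite -jump_omegaE => XE.
by apply/asboolP/asboolP => /XE.
Qed.

End UniformJumps.

(** * Ordinal notations *)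

Definition fin_notation (n : nat) : nat := iter n (expn 2) 1.

Lemma rec_fin_notation S : recursive S (fun=> fin_notation).
Proof.
have rdouble : recursive S (fun _ (u : nat * nat * nat) => u.2 + u.2).
  by apply: rec_add; apply: rec_snd; apply: rec_id.
have rexp : recursive S (fun _ (u : nat * nat) => 2 ^ u.2).
  have := rec_iter rdouble (rec_const 1) (rec_snd rec_id).
  by apply: rec_ext => _ x; elim: (x.2) => //= n ->; rewrite addnn -mul2n expnS.
exact: rec_iter rexp (rec_const 1) rec_id.
Qed.

Lemma kleeneO_fin_notation n : kleeneO (fin_notation n).
Proof. by elim: n => [|n IHn]; [exact: kleeneO_one | exact: kleeneO_succ]. Qed.

Lemma Hset_fin_notation n : Hset (fin_notation n) (iter n jump set0).
Proof. by elim: n => [|n IHn]; [exact: Hset_one | exact: Hset_succ]. Qed.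

(** The finite notations form a computable increasing sequence, hence a fundamental sequence for a
    notation of omega, whose H-set is [jump_omega]; the [k] remaining jumps are [k] successors of
    this notation. *)
Lemma arith_hyperarithmetical (X : set nat) :
  arith jump_omega X -> hyperarithmetical X.
Proof.
move=> [k [p pP]].
have [f fP] := rec_fin_notation [set set0].
have phif n : phi (prog_code f) n (fin_notation n).
  by apply/phi_relE; exact: fP.
have [limO limH] :
    kleeneO (3 * 5 ^ prog_code f) /\ Hset (3 * 5 ^ prog_code f) jump_omega.
  split; last exact: Hset_lim phif Hset_fin_notation.
  apply: kleeneO_lim phif kleeneO_fin_notation _ => n.
  exact: ltO_succ (kleeneO_fin_notation n).
exists (iter k (expn 2) (3 * 5 ^ prog_code f)), (iter k jump jump_omega); split.
- by elim: k {pP} => // k IHk; apply: kleeneO_succ.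
- by elim: k {pP} => // k IHk; apply: Hset_succ.
- exists (prog_code p) => x; have := pP _ erefl x.
  by case: asboolP => Xx px; split=> // _; apply/phi_relE.
Qed.

(** * The graph of the universal partial computable function *)

Lemma prog_code_comp p a b : prog_code p = pair_code 6 (pair_code a b) ->
  exists f g, [/\ p = PComp f g, prog_code f = a & prog_code g = b].
Proof.
by case: p => [||||| f g | f g | f g | f] /= /pair_code_inj[] // _
  /pair_code_inj[<- <-]; exists f, g.
Qed.

Lemma prog_code_pair p a b : prog_code p = pair_code 5 (pair_code a b) ->
  exists f g, [/\ p = PPair f g, prog_code f = a & prog_code g = b].
Proof.
by case: p => [||||| f g | f g | f g | f] /= /pair_code_inj[] // _
  /pair_code_inj[<- <-]; exists f, g.
Qed.

(** No universal program is built: [phi e x y] is the halting of a program that evaluates [e] at [x]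
    and diverges unless the result is [y], and the code of that program is computable from [e], [x]
    and [y]. If [e] is not the code of a program, the composite number is not one either. *)
Lemma arith_phi : arith set0 (fun z : nat * (nat * nat) => phi z.1 z.2.1 z.2.2).
Proof.
(* [w] does not look at the search variable: the search [PMu w] stops at once on a pair of equal
   entries and never ends on another pair. *)
have [w wP] : decidable_in setT (fun _ (z : nat * nat * nat) => z.1.1 <> z.1.2).
  by apply/dec_not/dec_eq; [apply: rec_fst|apply: rec_snd]; apply: rec_fst;
    apply: rec_id.
pose code (e x y : nat) := pair_code 6 (pair_code (prog_code (PMu w))
  (pair_code 5 (pair_code
    (pair_code 6 (pair_code e (prog_code (pconst x)))) (prog_code (pconst y))))).
have codeE e x y : jump set0 (code e x y) <-> phi e x y.
  have zP a b t : sem set0 w (pair_code (pair_code a b) t) `[<a <> b>].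
    exact: (wP set0 I ((a, b), t)).
  split=> [[v [p []]]|[p [<- pxy]]].
    move=> /prog_code_comp[m [f [-> /prog_code_inj-> ]]].
    move=> /prog_code_pair[g [h [-> + /prog_code_inj->]]].
    move=> /prog_code_comp[p' [k [-> p'E /prog_code_inj->]]].
    move=> /= [_ [[a [b [[x' [x'E p'a] bE ->]]] [wt _]]]].
    rewrite (sem_fun bE (sem_pconst _ _ _)) in wt.
    rewrite (sem_fun x'E (sem_pconst _ _ _)) in p'a.
    have := sem_fun (zP a y v) wt; case: asboolP => // /contrapT ay _.
    by exists p'; split=> //; rewrite -ay.
  exists 0, (PComp (PMu w) (PPair (PComp p (pconst x)) (pconst y))); split=> //.
  exists (pair_code y y); split; last first.
    by split=> //; have := zP y y 0; case: asboolP.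
  exists y, y; split=> //; last exact: sem_pconst.
  by exists x; split=> //; exact: sem_pconst.
have rcode : recursive [set jump set0]
    (fun _ (z : nat * (nat * nat)) => code z.1 z.2.1 z.2.2).
  do 3 apply: rec_pair_code (rec_const _) _.
  apply: rec_pair_code; last by apply/rec_pconst_code/rec_snd/rec_snd/rec_id.
  apply: rec_pair_code (rec_const _) _; apply: rec_pair_code.
    exact/rec_fst/rec_id.
  exact/rec_pconst_code/rec_fst/rec_snd/rec_id.
exists 1; have [p pP] := dec_oracle rcode; exists p => _ -> z.
have := pP _ erefl z; congr sem; congr (enc (nat_of_bool _)).
exact: asbool_equiv_eq.
Qed.

Lemma arith_computable (X : set nat) : computable X -> arith set0 X.
Proof.
(* A number that is not the code of a program is an index of the empty function, so convergence at 0
   supplies a program. *)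
move=> [e eP]; have [p pe] : exists p, prog_code p = e.
  have [h1 h2] := eP 0; have [/h1|/h2] := pselect (X 0); by case=> p [? _]; exists p.
exists 0, p => _ -> x; rewrite -pe in eP.
by have [h1 h2] := eP x; case: asboolP => [/h1|/h2] /phi_relE.
Qed.

(** * Arithmetical operations on lists *)

Section Lists.
Context {A : set nat} {T T' : Type} {cT : coded T} {cT' : coded T'}.

Lemma rec_cons S (F : set nat -> T -> T') (G : set nat -> T -> seq T') :
  recursive S F -> recursive S G -> recursive S (fun B x => F B x :: G B x).
Proof.
move=> /rec_enc rF /rec_enc rG.
by apply: rec_recode (rec_succ (rec_pair_code rF rG)).
Qed.

Lemma rec_behead S (G : set nat -> T -> seq T') :
  recursive S G -> recursive S (fun B x => behead (G B x)).
Proof.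
move=> /rec_enc rG.
have rs : recursive S (fun (_ : set nat) (n : nat) => (Cantor.of_nat n).2).
  by exists PSnd.
apply: rec_recode (rec_comp rs (rec_pred rG)) => B x.
by rewrite /enc /=; case: (G B x) => //= *; rewrite pair_codeE.
Qed.

Lemma arithf_cons (f : T -> T') (g : T -> seq T') :
  arithf A f -> arithf A g -> arithf A (fun x => f x :: g x).
Proof.
move=> [k /(rec_jumpW (leq_maxl k _)) rf] [k' /(rec_jumpW (leq_maxr _ _)) rg].
by exists (maxn k k'); apply: rec_cons (rf _) (rg _).
Qed.

End Lists.

Lemma arithf_drop {A T T'} {cT : coded T} {cT' : coded T'}
    (f : T -> nat) (g : T -> seq T') :
  arithf A f -> arithf A g -> arithf A (fun x => drop (f x) (g x)).
Proof.
apply: (arithf_rec2 (h := @drop T')).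
have r1 : recursive setT (fun _ (z : (nat * seq T') * seq T') => behead z.2).
  by apply/rec_behead/rec_snd/rec_id.
have := rec_iter r1 (rec_snd rec_id) (rec_fst rec_id).
apply: rec_ext => _ [n s] /=; elim: n s => [|n IHn] s; first by rewrite drop0.
by rewrite iterSr IHn; case: s.
Qed.

Lemma arith_mem {A T} {T' : eqType} {cT : coded T} {cT' : coded T'}
    (f : T -> T') (g : T -> seq T') :
  arithf A f -> arithf A g -> arith A (fun x => f x \in g x).
Proof.
move=> rf rg.
have : arith A (fun x => exists i t, drop i (g x) = f x :: t).
  apply: arith_ex; apply: arith_ex; apply: arith_eq.
    apply: arithf_drop; first by apply/arithf_snd/arithf_fst/arithf_id.
    by apply: (arithf_comp rg); apply/arithf_fst/arithf_fst/arithf_id.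
  apply: arithf_cons; last by apply/arithf_snd/arithf_id.
  by apply: (arithf_comp rf); apply/arithf_fst/arithf_fst/arithf_id.
apply: arith_ext => x; split=> [[i [t drop_i]]|].
  by rewrite -(cat_take_drop i (g x)) drop_i mem_cat mem_head orbT.
by move=> /path.splitPr[s t]; exists (size s), t; rewrite drop_size_cat.
Qed.

Lemma arithf_size {A T T'} {cT : coded T} {cT' : coded T'} (g : T -> seq T') :
  arithf A g -> arithf A (fun x => size (g x)).
Proof.
apply: (arithf_comp (g := @size T')).
apply: arithf_graph.
have : arith A (fun z : seq T' * nat => drop z.2 z.1 = [::] /\
    (forall m, m.+1 <= z.2 -> drop m z.1 <> [::])).
  apply: arith_and.
    apply: arith_eq (arithf_const _).
    by apply: arithf_drop; [apply: arithf_snd|apply: arithf_fst]; exact: arithf_id.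
  apply: arith_all; apply: arith_imp.
    apply: arith_leq; first by apply/arithf_succ/arithf_snd/arithf_id.
    by apply/arithf_snd/arithf_fst/arithf_id.
  apply/arith_not/arith_eq; last exact: arithf_const.
  apply: arithf_drop; first by apply/arithf_snd/arithf_id.
  by apply/arithf_fst/arithf_fst/arithf_id.
apply: arith_ext => -[s n] /=; split=> [[drop_n min_n]|->].
  apply/eqP; rewrite eqn_leq andbC.
  have -> : size s <= n by rewrite -subn_eq0 -size_drop drop_n.
  by rewrite leqNgt; apply/negP => /min_n; rewrite drop_size.
split=> [|m lt_m /(congr1 size)]; first exact: drop_size.
by rewrite size_drop => /eqP; rewrite subn_eq0 leqNgt lt_m.
Qed.

Lemma arithf_nth {A T} {cT : coded T} (g : T -> seq nat) (f : T -> nat) :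
  arithf A g -> arithf A f -> arithf A (fun x => nth 0 (g x) (f x)).
Proof.
move=> rg rf.
have rh : arithf A (fun s : seq nat => head 0 s).
  apply: recursive_arithf.
  have r1 : recursive setT (fun (_ : set nat) (n : nat) => (Cantor.of_nat n).1).
    by exists PFst.
  apply: rec_recode (rec_comp r1 (rec_pred (rec_enc rec_id))) => _ s.
  by rewrite /enc /=; case: s => //= *; rewrite pair_codeE.
have := arithf_comp rh (arithf_drop rf rg).
by under eq_fun do rewrite -nth0 nth_drop addn0.
Qed.

Lemma arith_const {A T} {cT : coded T} (P : Prop) : arith A (fun _ : T => P).
Proof. by exists 0; apply: rec_const. Qed.

(** A hook for the closure lemmas that come later; it is redefined once they are available. *)
Ltac arith_leaf := fail.

(** One closure lemma for each head symbol. Constants are caught before all compound shapes, and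
    implications before universal quantifiers. *)
Ltac arith_step := lazy beta; match goal with
  | |- arith _ (fun=> _) => apply: arith_const
  | |- arith _ (fun x => ~ _) => apply: arith_not
  | |- arith _ (fun x => _ /\ _) => apply: arith_and
  | |- arith _ (fun x => _ \/ _) => apply: arith_or
  | |- arith _ (fun x => _ <-> _) => apply: arith_iff
  | |- arith _ (fun x => exists y, _) => apply: arith_ex
  | |- arith _ (fun x => @?P x -> @?Q x) => apply: (@arith_imp _ _ _ P Q)
  | |- arith _ (fun x => forall y, _) => apply: arith_all
  | |- arith _ (fun x => @eq _ _ _) => apply: arith_eq
  | |- arith _ (fun x => is_true (leq _ _)) => apply: arith_leq
  | |- arith _ (fun x => is_true (in_mem (@?f x) (mem (@?g x)))) =>
      apply: (@arith_mem _ _ _ _ _ f g)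
  | |- arithf _ (fun x => x) => apply: arithf_id
  | |- arithf _ (fun=> _) => apply: arithf_const
  | H : arithf _ ?f |- arithf _ (fun x => ?f (@?g x)) =>
      apply: (arithf_comp (f := g) H)
  | |- arithf _ fst => exact: (arithf_fst arithf_id)
  | |- arithf _ snd => exact: (arithf_snd arithf_id)
  | |- arithf _ (fun x => (_, _)) => apply: arithf_pair
  | |- arithf _ (fun x => fst (@?f x)) => apply: (@arithf_fst _ _ _ _ _ _ _ f)
  | |- arithf _ (fun x => snd (@?f x)) => apply: (@arithf_snd _ _ _ _ _ _ _ f)
  | |- arithf _ (fun x => S _) => apply: arithf_succ
  | |- arithf _ (fun x => predn _) => apply: arithf_pred
  | |- arithf _ (fun x => addn _ _) => apply: arithf_add
  | |- arithf _ (fun x => subn _ _) => apply: arithf_sub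
  | |- arithf _ (fun x => muln _ _) => apply: arithf_mul
  | |- arithf _ (fun x => pair_code _ _) => apply: arithf_pair_code
  | |- arithf _ (fun x => cons _ _) => apply: arithf_cons
  | |- arithf _ (fun x => size _) => apply: arithf_size
  | |- arithf _ (fun x => nth 0 _ _) => apply: arithf_nth
  | _ => arith_leaf
  end.

Ltac arith := repeat arith_step.

Lemma arithf_map_nth {A T} {cT : coded T} (g h : T -> seq nat) :
  arithf A g -> arithf A h ->
  arithf A (fun x => [seq nth 0 (g x) i | i <- h x]).
Proof.
move=> rg rh.
apply: (arithf_comp (g := fun z => [seq nth 0 z.1 i | i <- z.2])
  _ (arithf_pair rg rh)).
apply: arithf_graph.
have : arith A (fun z : (seq nat * seq nat) * seq nat =>
    size z.2 = size z.1.2 /\ forall i, i < size z.2 ->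
    nth 0 z.2 i = nth 0 z.1.1 (nth 0 z.1.2 i)).
  by arith.
apply: arith_ext => -[[s u] v] /=; split=> [[sz eq_nth]|->].
  apply: (@eq_from_nth _ 0) => [|i lt_i]; first by rewrite size_map.
  by rewrite eq_nth // (nth_map 0) -?sz.
by rewrite size_map; split=> // i lt_i; rewrite (nth_map 0).
Qed.

(** * Rational thresholds and arithmetical real-valued functions *)

Section Thresholds.
Context {R : realType}.
Local Open Scope ring_scope.

(* The denominator is shifted, so that every pair codes a nonnegative rational. *)
Definition thr (d : nat * nat) : R := d.1%:R / d.2.+1%:R.

Lemma thr_ge0 d : 0 <= thr d.
Proof. by rewrite /thr divr_ge0. Qed.

Lemma thr_le d e : (thr d <= thr e) = (d.1 * e.2.+1 <= e.1 * d.2.+1)%N.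
Proof.
by rewrite /thr ler_pdivrMr ?ltr0n // mulrAC ler_pdivlMr ?ltr0n // -!natrM ler_nat.
Qed.

Lemma thr_lt d e : (thr d < thr e) = (d.1 * e.2.+1 < e.1 * d.2.+1)%N.
Proof. by rewrite ltNge thr_le -ltnNge. Qed.

Definition addt (d e : nat * nat) : nat * nat :=
  (d.1 * e.2.+1 + e.1 * d.2.+1, (d.2.+1 * e.2.+1).-1)%N.

Lemma thr_add d e : thr (addt d e) = thr d + thr e.
Proof.
rewrite /thr (_ : (addt d e).2.+1 = d.2.+1 * e.2.+1)%N ?prednK //.
by rewrite addf_div ?pnatr_eq0 // natrD !natrM.
Qed.

Lemma thr_nat n : thr (n, 0%N) = n%:R.
Proof. by rewrite /thr divr1. Qed.

Lemma thr0 : thr (0, 0)%N = 0.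
Proof. exact: thr_nat. Qed.

Definition rat_thr (r : rat) : nat * nat := (`|numq r|, `|denq r|.-1)%N.

Lemma rat_thrE (r : rat) : 0 <= r -> thr (rat_thr r) = ratr r.
Proof.
move=> r_ge0; rewrite /thr /ratr /= prednK ?absz_gt0 ?denq_neq0 //.
by rewrite !natr_absz (gtr0_norm (denq_gt0 r)) ger0_norm ?numq_ge0.
Qed.

Lemma thr_between (x y : R) : 0 <= x -> x < y -> exists2 d, x < thr d & thr d < y.
Proof.
move=> x_ge0 /rat_in_itvoo[r]; rewrite in_itv /= => /andP[ltxr ltry].
exists (rat_thr r); rewrite rat_thrE // -(ler0q R).
- exact: le_trans (ltW ltxr).
- exact: le_trans (ltW ltxr).
Qed.
End Thresholds.

Section RatCode.
Local Open Scope ring_scope.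

Definition rq (d : nat * nat) : rat := d.1%:R / d.2.+1%:R.

Lemma rq_ge0 d : 0 <= rq d.
Proof. by rewrite /rq divr_ge0. Qed.

Lemma ratr_rq {R : realType} d : ratr (rq d) = thr d :> R.
Proof. by rewrite /rq fmorph_div !rmorph_nat. Qed.

Lemma rat_thrK (r : rat) : 0 <= r -> rq (rat_thr r) = r.
Proof.
move=> r_ge0; rewrite /rq /= prednK ?absz_gt0 ?denq_neq0 //.
by rewrite !natr_absz (gtr0_norm (denq_gt0 r)) ger0_norm ?numq_ge0 // divq_num_den.
Qed.

(** [rat_code] reads the reduced fraction, while [d] is an arbitrary one. Multiplication and
    coprimality describe the reduced form, which is enough to define the graph of the code without
    computing a greatest common divisor. *)
Lemma rat_code_rqE d z : z = rat_code (rq d) <->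
  exists m n, [/\ z = pair_code m n, n != 0%N, coprime m n
    & (m * d.2.+1 = d.1 * n)%N].
Proof.
split=> [->|[m [n [-> n0 mn eq_mn]]]].
  exists `|numq (rq d)|%N, `|denq (rq d)|%N; split=> //.
  - by rewrite absz_eq0 denq_neq0.
  - exact: coprime_num_den.
  - have /eqP := divq_num_den (rq d); rewrite [X in _ == X]/rq.
    rewrite eqr_div ?pnatr_eq0 ?intr_eq0 ?denq_neq0 //.
    have [a ->] : exists a : nat, numq (rq d) = a.
      by exists `|numq (rq d)|%N; rewrite gez0_abs // numq_ge0 rq_ge0.
    have [b ->] : exists b : nat, denq (rq d) = b.
      by exists `|denq (rq d)|%N; rewrite gez0_abs // denq_ge0.
    by rewrite -!pmulrn -!natrM eqr_nat => /eqP.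
have -> : rq d = m%:~R / n%:~R.
  rewrite /rq; apply/eqP; rewrite eqr_div ?pnatr_eq0 //.
  by rewrite -!natrM eqr_nat eq_mn.
rewrite /rat_code; congr pair_code.
- by rewrite coprimeq_num // gtr0_sg ?mul1r ?absz_nat // ltz_nat lt0n.
- by rewrite coprimeq_den //; case: n n0 {mn eq_mn}.
Qed.

End RatCode.

Lemma arithf_rat_code {A T} {cT : coded T} (d : T -> nat * nat) :
  arithf A d -> arithf A (fun x => rat_code (rq (d x))).
Proof.
apply: (arithf_comp (g := fun d => rat_code (rq d))).
apply: arithf_graph.
have : arith A (fun z : (nat * nat) * nat => exists m n,
    [/\ z.2 = pair_code m n, n <> 0,
        (forall g m' n', m = g * m' -> n = g * n' -> g = 1)
      & m * z.1.2.+1 = z.1.1 * n]).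
  have : arith A (fun z : (nat * nat) * nat => exists m n,
    z.2 = pair_code m n /\ n <> 0 /\
        (forall g m' n', m = g * m' -> n = g * n' -> g = 1)
      /\ m * z.1.2.+1 = z.1.1 * n) by arith.
  by apply: arith_ext => z; split=> [[m [n [? [? []]]]]|[m [n []]]]; exists m, n.
apply: arith_ext => z; rewrite rat_code_rqE.
split=> -[m [n [zE /eqP n0 mn ?]]]; exists m, n; split=> //.
- have /dvdnP[m' mE] := dvdn_gcdl m n; have /dvdnP[n' nE] := dvdn_gcdr m n.
  by apply/eqP; apply: mn; rewrite mulnC; [exact: mE | exact: nE].
- move=> g m' n' mE nE; apply/eqP; rewrite -dvdn1 -(eqP mn) dvdn_gcd.
  by rewrite [X in _ %| X]mE [X in _ && (_ %| X)]nE !dvdn_mulr.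
Qed.

Section ArithReal.
Context {R : realType} {A : set nat}.
Local Open Scope ring_scope.

(** Strict upper cuts are chosen because an infimum is below [d] exactly when one of the values is.
    Thresholds are nonnegative, so the cuts determine only nonnegative functions; hence the sign
    hypotheses in the lemmas that compare or combine functions. *)
Definition arithr {T} {cT : coded T} (f : T -> R) : Prop :=
  arith A (fun z : T * (nat * nat) => f z.1 < thr z.2).

Lemma arith_thr_lt {T} {cT : coded T} (d e : T -> nat * nat) :
  arithf A d -> arithf A e -> arith A (fun x => thr (d x) < thr (e x) :> R).
Proof.
move=> rd re.
have : arith A (fun x => ((d x).1 * (e x).2.+1 < (e x).1 * (d x).2.+1)%N).
  by arith.
by apply: arith_ext => x; rewrite thr_lt.
Qed.

Lemma arith_thr_le {T} {cT : coded T} (d e : T -> nat * nat) :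
  arithf A d -> arithf A e -> arith A (fun x => thr (d x) <= thr (e x) :> R).
Proof.
move=> rd re.
have : arith A (fun x => ((d x).1 * (e x).2.+1 <= (e x).1 * (d x).2.+1)%N).
  by arith.
by apply: arith_ext => x; rewrite thr_le.
Qed.

Lemma arithf_addt {T} {cT : coded T} (d e : T -> nat * nat) :
  arithf A d -> arithf A e -> arithf A (fun x => addt (d x) (e x)).
Proof. by move=> rd re; rewrite /addt; arith. Qed.

Lemma arithr_ext {T} {cT : coded T} (f g : T -> R) : f =1 g -> arithr f -> arithr g.
Proof. by move=> fg; apply: arith_ext => z; rewrite fg. Qed.

Lemma arithr_comp {T T'} {cT : coded T} {cT' : coded T'} (h : T' -> R) (u : T -> T') :
  arithr h -> arithf A u -> arithr (fun x => h (u x)).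
Proof.
move=> rh ru; apply: (arith_comp (f := fun z => (u z.1, z.2)) rh).
by apply: arithf_pair; [apply: (arithf_comp ru)|]; arith.
Qed.

Lemma arith_lt_thr {T} {cT : coded T} (f : T -> R) (d : T -> nat * nat) :
  arithr f -> arithf A d -> arith A (fun x => f x < thr (d x)).
Proof.
move=> rf rd; apply: (arith_comp (f := fun x => (x, d x)) rf).
by apply: arithf_pair => //; arith.
Qed.

Lemma arithr_thr {T} {cT : coded T} (d : T -> nat * nat) :
  arithf A d -> arithr (fun x => thr (d x)).
Proof.
by move=> rd; apply: arith_thr_lt; [apply: (arithf_comp rd)|]; arith.
Qed.

Lemma arithr_max {T} {cT : coded T} (f g : T -> R) :
  arithr f -> arithr g -> arithr (fun x => Num.max (f x) (g x)).
Proof.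
move=> rf rg; apply: arith_ext (arith_and rf rg) => z.
by rewrite gt_max; split=> /andP.
Qed.

Lemma arithr_if {T} {cT : coded T} (P : T -> Prop) (f g : T -> R) :
  arith A P -> arithr f -> arithr g ->
  arithr (fun x => if `[<P x>] then f x else g x).
Proof.
move=> rP rf rg.
have rP1 : arith A (fun z : T * (nat * nat) => P z.1).
  by apply: (arith_comp rP); arith.
have := arith_or (arith_and rP1 rf) (arith_and (arith_not rP1) rg).
by apply: arith_ext => z; case: asboolP => ?; tauto.
Qed.

(** A rational [d] with [f x < d <= g x] separates the values, and both conditions are questions
    about upper cuts. *)
Lemma arith_lt {T} {cT : coded T} (f g : T -> R) : (forall x, 0 <= f x) ->
  arithr f -> arithr g -> arith A (fun x => f x < g x).
Proof.
move=> f_ge0 rf rg.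
have : arith A (fun x => exists d, f x < thr d /\ ~ (g x < thr d)).
  apply: arith_ex; apply: arith_and.
    by apply: (arith_lt_thr (f := fun z => f z.1)); [apply: (arithr_comp rf)|]; arith.
  apply: arith_not.
  by apply: (arith_lt_thr (f := fun z => g z.1)); [apply: (arithr_comp rg)|]; arith.
apply: arith_ext => x; split=> [[d [fd /negP]]|fg].
  by rewrite -leNgt; apply: lt_le_trans.
have [d fd dg] := thr_between (f_ge0 x) fg.
by exists d; split=> //; apply/negP; rewrite -leNgt ltW.
Qed.

Lemma arith_le {T} {cT : coded T} (f g : T -> R) : (forall x, 0 <= g x) ->
  arithr f -> arithr g -> arith A (fun x => f x <= g x).
Proof.
move=> g_ge0 rf rg; apply: arith_ext (arith_not (arith_lt g_ge0 rg rf)) => x.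
by rewrite leNgt; split=> /negP.
Qed.

Lemma arithr_add {T} {cT : coded T} (f g : T -> R) :
  (forall x, 0 <= f x) -> (forall x, 0 <= g x) ->
  arithr f -> arithr g -> arithr (fun x => f x + g x).
Proof.
move=> f_ge0 g_ge0 rf rg.
have : arith A (fun z : T * (nat * nat) => exists d e,
    f z.1 < thr d /\ g z.1 < thr e /\ thr (addt d e) <= thr z.2 :> R).
  do 2 apply: arith_ex; apply: arith_and; last apply: arith_and.
  - apply: (arith_lt_thr (f := fun z => f z.1.1.1)); last by arith.
    by apply: (arithr_comp rf); arith.
  - apply: (arith_lt_thr (f := fun z => g z.1.1.1)); last by arith.
    by apply: (arithr_comp rg); arith.
  - by apply: arith_thr_le; [apply: arithf_addt|]; arith.
apply: arith_ext => -[x c] /=; split=> [[d [e [fd [ge]]]]|fgc].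
  by rewrite thr_add; apply: lt_le_trans; apply: ltrD.
have [d fd dc] : exists2 d, f x < thr d & thr d < thr c - g x :> R.
  by apply: thr_between => //; rewrite ltrBrDr.
have [e ge ec] : exists2 e, g x < thr e & thr e < thr c - thr d :> R.
  by apply: thr_between => //; rewrite ltrBrDl -ltrBrDr.
by exists d, e; split=> //; split=> //; rewrite thr_add ltW // -ltrBrDl.
Qed.

(** This is the shape that the uniform lemma on jumps requires of a connective: one existential
    quantifier over a rational [d <= y], in front of a question on the cut of [x] and one on the cut
    of [y]. *)
Lemma lt_subt (x y c : R) : 0 <= x -> 0 <= y -> 0 <= c ->
  Num.max (x - y) 0 < c <->
  0 < c /\ exists d, x < thr d + c /\ ~ (y < thr d).
Proof.
move=> x_ge0 y_ge0 c_ge0; rewrite gt_max; split=> [/andP[xyc c_gt0]|].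
  (* If [x < c] the rational 0 serves; otherwise [x - c] is nonnegative, as [thr_between]
     requires. *)
  split=> //; have [xc|cx] := ltP x c.
    by exists (0%N, 0%N); rewrite thr_nat add0r; split=> //; apply/negP; rewrite -leNgt.
  have [d xd dy] : exists2 d, x - c < thr d & thr d < y.
    by apply: thr_between; rewrite ?subr_ge0 // ltrBlDl -ltrBlDr.
  by exists d; rewrite -ltrBlDr; split=> //; apply/negP; rewrite -leNgt ltW.
move=> [c_gt0 [d [xd /negP]]]; rewrite -leNgt c_gt0 andbT => dy.
by rewrite ltrBlDr (lt_le_trans xd) // addrC lerD2l.
Qed.

Lemma arithr_subt {T} {cT : coded T} (f g : T -> R) :
  (forall x, 0 <= f x) -> (forall x, 0 <= g x) ->
  arithr f -> arithr g -> arithr (fun x => Num.max (f x - g x) 0).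
Proof.
move=> f_ge0 g_ge0 rf rg.
have : arith A (fun z : T * (nat * nat) => thr (0%N, 0%N) < thr z.2 :> R /\
    exists d, f z.1 < thr (addt d z.2) /\ ~ (g z.1 < thr d)).
  apply: arith_and; first by apply: arith_thr_lt; arith.
  apply: arith_ex; apply: arith_and; last apply: arith_not.
  - apply: (arith_lt_thr (f := fun z => f z.1.1)); last by apply: arithf_addt; arith.
    by apply: (arithr_comp rf); arith.
  - apply: (arith_lt_thr (f := fun z => g z.1.1)); last by arith.
    by apply: (arithr_comp rg); arith.
apply: arith_ext => -[x c]; rewrite lt_subt ?thr_ge0 // thr_nat.
by split=> -[? [d []]] fdc gd; split=> //; exists d; rewrite thr_add in fdc *.
Qed.

Lemma arithr_dist {T} {cT : coded T} (f g : T -> R) :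
  (forall x, 0 <= f x) -> (forall x, 0 <= g x) ->
  arithr f -> arithr g -> arithr (fun x => `|f x - g x|).
Proof.
move=> f_ge0 g_ge0 rf rg.
have := arithr_max (arithr_subt f_ge0 g_ge0 rf rg) (arithr_subt g_ge0 f_ge0 rg rf).
apply: arithr_ext => x.
have [le_fg|lt_gf] := leP (f x) (g x).
  rewrite (max_r (y := 0)) ?subr_le0 // (max_l (y := 0)) ?subr_ge0 //.
  by rewrite max_r ?subr_ge0 // ler0_norm ?subr_le0 // opprB.
rewrite (max_l (y := 0)) ?subr_ge0 ?ltW // (max_r (y := 0)) ?subr_le0 ?ltW //.
by rewrite max_l ?subr_ge0 ?ltW // ger0_norm // subr_ge0 ltW.
Qed.

End ArithReal.

(** * Structures determined by their values on a dense sequence *)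

Section Metric.
Local Open Scope ring_scope.
Context {R : realType} {U : metricType R}.
Implicit Types x y z : U.

Lemma mdist_dist x y x' y' : `|mdist x y - mdist x' y'| <= mdist x x' + mdist y y'.
Proof.
have half (a b a' b' : U) :
      mdist a b - mdist a' b' <= mdist a a' + mdist b b'.
  rewrite lerBlDr -addrA [mdist b b' + _]addrC.
  apply: le_trans (metric_triangle a a' b) _; rewrite lerD2l.
  by rewrite (metric_sym b); apply: metric_triangle.
rewrite ler_norml half andbT lerNl opprB.
by rewrite (metric_sym x x') (metric_sym y y') half.
Qed.

Lemma dense_range_approx (q : nat -> U) x e :
  dense (range q) -> 0 < e -> exists m, mdist x (q m) < e.
Proof.
move=> dq e_gt0; have [] := dq (interior (ball x e)).
- by exists x; apply: nbhsx_ballx.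
- exact: open_interior.
move=> z [/interior_subset xz [m _ mz]]; exists m.
by rewrite ballEmdist in xz; rewrite mz.
Qed.

(** A supremum equal to 1 cannot be the default value 0 of [sup], so the set of distances is bounded
    and 1 is an upper bound of it. *)
Lemma urysohn1_le1 x y : urysohn1 U -> mdist x y <= 1.
Proof.
move=> [_ + _ _]; rewrite /diameter; set D := [set r | _] => supD.
rewrite -supD; apply: ub_le_sup; last by exists x, y.
apply: contrapT => nubD.
have : sup D = 0 by apply: sup_out => -[].
by rewrite supD => /eqP; rewrite oner_eq0.
Qed.

End Metric.

Section Values.
Local Open Scope ring_scope.
Context {R : realType} {U : metricType R} {L : signature}.
Variable M : lstructure U L.

(** Predicates are Lipschitz in each variable separately; the hybrids lead from [x] to [y] by
    changing one coordinate at a time. *)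
Definition hybrid (T : Type) n (x y : n.-tuple T) m : n.-tuple T :=
  [tuple if (i < m)%N then tnth y i else tnth x i | i < n].

Lemma interp_continuous (j : symbol L) (x y : (ar j).-tuple U) e :
  (forall i, mdist (tnth x i) (tnth y i) <= e) ->
  `|interp M x - interp M y| <= (ar j)%:R * e.
Proof.
move=> xy_e.
have step m : (m <= ar j)%N -> `|interp M x - interp M (hybrid x y m)| <= m%:R * e.
  elim: m => [_|m IHm lt_m].
    rewrite mul0r (_ : hybrid x y 0 = x) ?subrr ?normr0 //.
    by apply: eq_from_tnth => i; rewrite tnth_mktuple ltn0.
  apply: le_trans (ler_distD (interp M (hybrid x y m)) _ _) _.
  rewrite -natr1 mulrDl mul1r lerD ?IHm ?(ltnW lt_m) //.
  apply: le_trans (interp_lipschitz (i := Ordinal lt_m) M _) _ => [k nk|].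
    rewrite !tnth_mktuple (_ : (k < m.+1)%N = (k < m)%N) //.
    rewrite ltnS [LHS]leq_eqVlt; case: (eqVneq (k : nat) m) => // km.
    by case/eqP: nk; apply: val_inj.
  by rewrite !tnth_mktuple ltnn ltnSn.
have := step (ar j) (leqnn _); rewrite (_ : hybrid x y (ar j) = y) //.
by apply: eq_from_tnth => i; rewrite tnth_mktuple ltn_ord.
Qed.

End Values.

(** * Range and uniform continuity of the values of formulas *)

Section FormulaValues.
Local Open Scope ring_scope.
Context {R : realType} {U : metricType R} {L : signature}.
Variables (M : lstructure U L) (x0 : U).
Hypothesis mdist_le1 : forall x y : U, mdist x y <= 1.

Lemma formula_val_range n (f : formula L n) a : 0 <= formula_val M f a <= 1.
Proof.
elim: f a => {n} /= [n|n|n i j|n j v|n f IHf|n f IHf g IHg|n f IHf g IHg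
  |n f IHf g IHg|n f IHf g IHg|n f IHf|n f IHf g IHg|n r r0 f IHf|n f IHf
  |n f IHf] a; try (have /andP[f0 f1] := IHf a); try (have /andP[g0 g1] := IHg a).
- by rewrite lexx ler01.
- by rewrite lexx ler01.
- by rewrite mdist_ge0 mdist_le1.
- exact: interp_range.
- by apply/andP; split; lra.
- by rewrite le_max lexx orbT ge_max ler01 andbT; lra.
- by rewrite le_min f0 g0 ge_min f1.
- by rewrite le_max f0 ge_max f1 g1.
- by rewrite normr_ge0 ler_norml; apply/andP; split; lra.
- by rewrite subr_ge0 f1 lerBlDr lerDl f0.
- rewrite ge_min lexx orbT andbT le_min; apply/andP; split; lra.
- rewrite ge_min lexx orbT andbT le_min ler01 andbT.
  by rewrite mulr_ge0 // ler0q ltW.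
- have bnd : has_sup (range (fun x => formula_val M f (rcons_tuple a x))).
    split; first by exists (formula_val M f (rcons_tuple a x0)), x0.
    by exists 1 => _ [x _ <-]; have /andP[] := IHf (rcons_tuple a x).
  apply/andP; split; last first.
    apply: ge_sup => [|_ [x _ <-]]; first by case: bnd.
    by have /andP[] := IHf (rcons_tuple a x).
  have /andP[f0 _] := IHf (rcons_tuple a x0); apply: le_trans f0 _.
  by apply: ub_le_sup; [case: bnd | exists x0].
- have bnd : has_inf (range (fun x => formula_val M f (rcons_tuple a x))).
    split; first by exists (formula_val M f (rcons_tuple a x0)), x0.
    by exists 0 => _ [x _ <-]; have /andP[] := IHf (rcons_tuple a x).
  apply/andP; split.
    apply: lb_le_inf => [|_ [x _ <-]]; first by case: bnd.
    by have /andP[] := IHf (rcons_tuple a x).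
  have /andP[_ f1] := IHf (rcons_tuple a x0); apply: le_trans _ f1.
  by apply: ge_inf; [case: bnd | exists x0].
Qed.

Lemma formula_val_ge0 n (f : formula L n) a : 0 <= formula_val M f a.
Proof. by have /andP[] := formula_val_range f a. Qed.

Lemma formula_val_le1 n (f : formula L n) a : formula_val M f a <= 1.
Proof. by have /andP[] := formula_val_range f a. Qed.

Lemma has_inf_formula_val n (f : formula L n.+1) a :
  has_inf (range (fun x => formula_val M f (rcons_tuple a x))).
Proof.
split; first by exists (formula_val M f (rcons_tuple a x0)), x0.
by exists 0 => _ [x _ <-]; apply: formula_val_ge0.
Qed.

Lemma has_sup_formula_val n (f : formula L n.+1) a :
  has_sup (range (fun x => formula_val M f (rcons_tuple a x))).
Proof.
split; first by exists (formula_val M f (rcons_tuple a x0)), x0.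
by exists 1 => _ [x _ <-]; apply: formula_val_le1.
Qed.

(** Reduces suprema to infima, the quantifier whose strict upper cuts are existential. *)
Lemma formula_val_sup_inf n (f : formula L n.+1) a :
  formula_val M (CSup f) a = 1 - formula_val M (CInf (CNeg f)) a.
Proof.
have [infne infb] := has_inf_formula_val (CNeg f) a.
have [supne supb] := has_sup_formula_val f a.
apply/eqP; rewrite eq_le; apply/andP; split.
  apply: ge_sup => // _ [x _ <-]; rewrite lerBrDr -lerBrDl.
  by apply: ge_inf => //; exists x.
rewrite lerBlDr -lerBlDl; apply: lb_le_inf => // _ [x _ <-] /=.
rewrite lerBlDl -lerBlDr opprB addrC subrK.
by apply: ub_le_sup => //; exists x.
Qed.

(** Every connective is Lipschitz, and a quantifier keeps the constant of its body. The purpose is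
    to let a quantifier over [U] range over a dense sequence. *)
Lemma formula_val_continuous n (f : formula L n) : exists K : nat,
  forall (a b : n.-tuple U) e, 0 <= e ->
  (forall i, mdist (tnth a i) (tnth b i) <= e) ->
  `|formula_val M f a - formula_val M f b| <= K%:R * e.
Proof.
have dist_max (x y x' y' d1 d2 : R) : `|x - x'| <= d1 -> `|y - y'| <= d2 ->
    `|Num.max x y - Num.max x' y'| <= d1 + d2.
  rewrite !ler_norml => /andP[? ?] /andP[? ?].
  by case: (leP x y) => ?; case: (leP x' y') => ?; apply/andP; split; lra.
have dist_min (x y x' y' d1 d2 : R) : `|x - x'| <= d1 -> `|y - y'| <= d2 ->
    `|Num.min x y - Num.min x' y'| <= d1 + d2.
  rewrite !ler_norml => /andP[? ?] /andP[? ?].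
  by case: (leP x y) => ?; case: (leP x' y') => ?; apply/andP; split; lra.
have dist_sub (x y x' y' d1 d2 : R) : `|x - x'| <= d1 -> `|y - y'| <= d2 ->
    `|(x - y) - (x' - y')| <= d1 + d2.
  rewrite !ler_norml => /andP[? ?] /andP[? ?]; apply/andP; split; lra.
have dist_abs (x y x' y' d1 d2 : R) : `|x - x'| <= d1 -> `|y - y'| <= d2 ->
    `| `|x - y| - `|x' - y'| | <= d1 + d2.
  by move=> ? ?; apply: le_trans (ler_dist_dist _ _) _; apply: dist_sub.
have dist_le (x y c : R) : x <= y + c -> y <= x + c -> `|x - y| <= c.
  by move=> ? ?; rewrite ler_norml; apply/andP; split; lra.
have dist00 (x : R) : `|x - x| <= 0 by rewrite subrr normr0.
have rcons_le m (a b : m.-tuple U) e x : 0 <= e ->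
    (forall i, mdist (tnth a i) (tnth b i) <= e) ->
    forall i, mdist (tnth (rcons_tuple a x) i) (tnth (rcons_tuple b x) i) <= e.
  move=> e0 ab i; rewrite !(tnth_nth x) /= !nth_rcons !size_tuple.
  case: ltngtP => lt_i; rewrite ?mdistxx //.
  by have := ab (Ordinal lt_i); rewrite !(tnth_nth x).
elim: f => {n} /= [n|n|n i j|n j v|n f [K IHf]|n f [K IHf] g [K' IHg]
  |n f [K IHf] g [K' IHg]|n f [K IHf] g [K' IHg]|n f [K IHf] g [K' IHg]
  |n f [K IHf]|n f [K IHf] g [K' IHg]|n r r0 f [K IHf]|n f [K IHf]
  |n f [K IHf]].
- by exists 0%N => a b e _ _; rewrite subrr normr0 mul0r.
- by exists 0%N => a b e _ _; rewrite subrr normr0 mul0r.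
- exists 2%N => a b e _ ab; apply: le_trans (mdist_dist _ _ _ _) _.
  by rewrite mulr_natl mulr2n lerD.
- exists (ar j) => a b e _ ab; apply: interp_continuous => i.
  by rewrite !tnth_map.
- exists K => a b e e0 /(IHf _ _ _ e0) h.
  rewrite -mulrBl normrM (ger0_norm (x := 2^-1)) ?invr_ge0 //.
  by have := normr_ge0 (formula_val M f a - formula_val M f b); lra.
- exists (K + K')%N => a b e e0 ab; rewrite natrD mulrDl -[leRHS]addr0.
  by apply: dist_max => //; apply: dist_sub; [apply: IHf|apply: IHg].
- exists (K + K')%N => a b e e0 ab; rewrite natrD mulrDl.
  by apply: dist_min; [apply: IHf|apply: IHg].
- exists (K + K')%N => a b e e0 ab; rewrite natrD mulrDl.
  by apply: dist_max; [apply: IHf|apply: IHg].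
- exists (K + K')%N => a b e e0 ab; rewrite natrD mulrDl.
  by apply: dist_abs; [apply: IHf|apply: IHg].
- exists K => a b e e0 ab; rewrite -[leRHS]add0r.
  by apply: dist_sub => //; apply: IHf.
- exists (K + K')%N => a b e e0 ab; rewrite natrD mulrDl -[leRHS]addr0.
  apply: dist_min => //; rewrite opprD addrACA.
  by apply: le_trans (ler_normD _ _) _; rewrite lerD ?IHf ?IHg.
(* A positive rational is at most its numerator, which keeps the constant an integer. *)
- exists (`|numq r| * K)%N => a b e e0 ab; rewrite -[leRHS]addr0.
  apply: dist_min => //; rewrite -mulrBr normrM natrM -mulrA.
  apply: ler_pM => //; last exact: IHf.
  rewrite gtr0_norm ?ltr0q // natr_absz gtr0_norm ?numq_gt0 //.
  rewrite /ratr ler_pdivrMr ?ltr0z ?denq_gt0 //.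
  apply: ler_peMr; first by rewrite ler0z numq_ge0 ltW.
  by rewrite ler1z -gtz0_ge1 denq_gt0.
- exists K => a b e e0 ab.
  have half (c d : n.-tuple U) : (forall i, mdist (tnth c i) (tnth d i) <= e) ->
      formula_val M (CSup f) c <= formula_val M (CSup f) d + K%:R * e.
    move=> cd; apply: ge_sup => [|_ [x _ <-]]; first by case: (has_sup_formula_val f c).
    have := IHf _ _ _ e0 (rcons_le _ _ _ _ x e0 cd).
    rewrite ler_norml => /andP[_]; rewrite lerBlDl => /le_trans; apply.
    by rewrite lerD2r; apply: ub_le_sup; [case: (has_sup_formula_val f d)|exists x].
  have ba i : mdist (tnth b i) (tnth a i) <= e by rewrite metric_sym.
  exact: dist_le (half _ _ ab) (half _ _ ba).
- exists K => a b e e0 ab.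
  have half (c d : n.-tuple U) : (forall i, mdist (tnth c i) (tnth d i) <= e) ->
      formula_val M (CInf f) c <= formula_val M (CInf f) d + K%:R * e.
    move=> cd; rewrite -lerBlDr; apply: lb_le_inf => [|_ [x _ <-]].
      by case: (has_inf_formula_val f d).
    have := IHf _ _ _ e0 (rcons_le _ _ _ _ x e0 cd).
    rewrite ler_norml => /andP[_]; rewrite lerBlDl lerBlDr addrC; apply: le_trans.
    by apply: ge_inf; [case: (has_inf_formula_val f c)|exists x].
  have ba i : mdist (tnth b i) (tnth a i) <= e by rewrite metric_sym.
  exact: dist_le (half _ _ ab) (half _ _ ba).
Qed.

Lemma inf_dense n (f : formula L n.+1) (q : nat -> U) a : dense (range q) ->
  formula_val M (CInf f) a =
    inf (range (fun m => formula_val M f (rcons_tuple a (q m)))).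
Proof.
move=> dq; apply/eqP; rewrite eq_le; apply/andP; split.
  apply: lb_le_inf => [|_ [m _ <-]]; first by eexists; exists 0%N.
  by apply: ge_inf; [case: (has_inf_formula_val f a) | exists (q m)].
apply: lb_le_inf => [|_ [x _ <-]]; first by case: (has_inf_formula_val f a).
have [K KP] := formula_val_continuous f.
apply/ler_addgt0Pr => e e_gt0.
(* The denominator is [K.+1] because [K] may be 0; the value then changes by at most
   [K * e / (K + 1) <= e]. *)
have [m xm] := dense_range_approx x dq (divr_gt0 e_gt0 (ltr0Sn R K)).
apply: le_trans (_ : formula_val M f (rcons_tuple a (q m)) <= _).
  apply: ge_inf; last by exists m.
  by exists 0 => _ [y _ <-]; apply: formula_val_ge0.
have := KP (rcons_tuple a (q m)) (rcons_tuple a x) (e / K.+1%:R).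
have le_e i : mdist (tnth (rcons_tuple a (q m)) i) (tnth (rcons_tuple a x) i)
    <= e / K.+1%:R.
  rewrite !(tnth_nth x) /= !nth_rcons size_tuple.
  case: ltngtP => _; rewrite ?mdistxx ?divr_ge0 ?(ltW e_gt0) //.
  by rewrite metric_sym ltW.
move=> /(_ (divr_ge0 (ltW e_gt0) (ler0n _ _)) le_e).
rewrite ler_norml => /andP[_]; rewrite lerBlDl => /le_trans.
apply; rewrite lerD2l mulrCA ler_piMr ?(ltW e_gt0) //.
by rewrite ler_pdivrMr // mul1r ler_nat.
Qed.

End FormulaValues.

(** * McShane's extension of predicates given on a sequence of points *)

Section McShane.
Local Open Scope ring_scope.
Context {R : realType} {U : metricType R} {L : signature}.
Variables (q : nat -> U) (w : forall j : symbol L, (ar j).-tuple nat -> R).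
Hypothesis w_range : forall j (s : (ar j).-tuple nat), 0 <= w s <= 1.
Hypothesis w_lipschitz : forall j (i : 'I_(ar j)) (s t : (ar j).-tuple nat),
  (forall k, k != i -> tnth s k = tnth t k) ->
  w s <= w t + qdist q (tnth s i) (tnth t i).

(** Being 1-Lipschitz in each variable separately amounts to being 1-Lipschitz for the sum metric on
    tuples, and McShane's formula is taken for that metric. *)
Let upper j (x : (ar j).-tuple U) (s : (ar j).-tuple nat) : R :=
  w s + \sum_(k < ar j) mdist (tnth x k) (q (tnth s k)).

(** The truncation keeps the values in [0, 1] even at tuples far from the points of the sequence,
    and it preserves the Lipschitz condition. *)
Let extension j (x : (ar j).-tuple U) : R := Num.min (inf (range (upper x))) 1.

Let upper_ge0 j (x : (ar j).-tuple U) s : 0 <= upper x s.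
Proof.
have /andP[w_ge0 _] := w_range s.
by rewrite addr_ge0 // sumr_ge0 // => k _; apply: mdist_ge0.
Qed.

Let upper_nonempty j (x : (ar j).-tuple U) : range (upper x) !=set0.
Proof. by exists (upper x [tuple of nseq (ar j) 0%N]); exists [tuple of nseq (ar j) 0%N]. Qed.

Let upper_lb j (x : (ar j).-tuple U) : has_lbound (range (upper x)).
Proof. by exists 0 => _ [s _ <-]; apply: upper_ge0. Qed.

Let w_hybrid j (s t : (ar j).-tuple nat) :
  w s <= w t + \sum_(k < ar j) qdist q (tnth s k) (tnth t k).
Proof.
have step m : (m <= ar j)%N -> w s <= w (hybrid s t m) +
    \sum_(k < ar j | (k < m)%N) qdist q (tnth s k) (tnth t k).
  elim: m => [_|m IHm lt_m].
    rewrite big_pred0 // addr0 (_ : hybrid s t 0 = s) //.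
    by apply: eq_from_tnth => i; rewrite tnth_mktuple ltn0.
  apply: le_trans (IHm (ltnW lt_m)) _.
  rewrite [in leRHS](bigD1 (Ordinal lt_m)) //= addrA lerD //; last first.
    rewrite le_eqVlt; apply/orP; left; apply/eqP; apply: eq_bigl => k.
    by rewrite ltnS -val_eqE /= ltn_neqAle andbC.
  have := @w_lipschitz j (Ordinal lt_m) (hybrid s t m) (hybrid s t m.+1).
  rewrite !tnth_mktuple /= ltnn ltnSn; apply=> k nk.
  rewrite !tnth_mktuple (_ : (k < m.+1)%N = (k < m)%N) //.
  rewrite ltnS [LHS]leq_eqVlt; case: (eqVneq (k : nat) m) => // km.
  by case/eqP: nk; apply: val_inj.
have := step (ar j) (leqnn _); rewrite (_ : hybrid s t (ar j) = t).
  by under eq_bigl do rewrite ltn_ord.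
by apply: eq_from_tnth => i; rewrite tnth_mktuple ltn_ord.
Qed.

Lemma mcshane_extension : exists M : lstructure U L,
  forall j (s : (ar j).-tuple nat), interp M (map_tuple q s) = w s.
Proof.
have ext_range j (x : (ar j).-tuple U) : 0 <= extension x <= 1.
  rewrite /extension ge_min lexx orbT andbT le_min ler01 andbT.
  by apply: lb_le_inf => // _ [s _ <-].
have ext_lip (j : symbol L) (i : 'I_(ar j)) (x y : (ar j).-tuple U) :
    (forall k, k != i -> tnth x k = tnth y k) ->
    extension x <= extension y + mdist (tnth x i) (tnth y i).
  move=> xy; rewrite /extension addr_minl le_min !ge_min lerDl mdist_ge0 orbT andbT.
  apply/orP; left; rewrite -lerBlDr; apply: lb_le_inf => // _ [s _ <-].
  rewrite lerBlDr; apply: le_trans (_ : upper x s <= _).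
    by apply: ge_inf => //; exists s.
  rewrite /upper -addrA lerD2l (bigD1 i) //= [in leRHS](bigD1 i) //= addrAC.
  rewrite lerD //.
    by rewrite addrC; apply: metric_triangle.
  by rewrite le_eqVlt; apply/orP; left; apply/eqP; apply: eq_bigr => k /xy->.
have ext_lipschitz (j : symbol L) (i : 'I_(ar j)) (x y : (ar j).-tuple U) :
    (forall k, k != i -> tnth x k = tnth y k) ->
    `|extension x - extension y| <= mdist (tnth x i) (tnth y i).
  move=> xy; rewrite ler_norml lerNl opprB !lerBlDl.
  rewrite ext_lip // andbT (metric_sym (tnth x i)).
  by apply: ext_lip => k /xy.
exists (@Structure R U L extension ext_range ext_lipschitz) => j s /=.
have /andP[w_ge0 w_le1] := w_range s.
(* At a tuple of the sequence the infimum is attained by the tuple itself; the other terms are at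
   least [w s] by the Lipschitz condition. *)
rewrite /extension (_ : inf _ = w s) ?min_l //.
apply/eqP; rewrite eq_le; apply/andP; split.
  apply: ge_inf => //; exists s => //; rewrite /upper big1 ?addr0 // => k _.
  by rewrite tnth_map mdistxx.
apply: lb_le_inf => // _ [t _ <-]; rewrite /upper.
under eq_bigr do rewrite tnth_map.
exact: w_hybrid.
Qed.

End McShane.

(** * Structures recovered from their indices *)

Definition uncode {T} {cT : coded T} (n : nat) : T := sval (cid (enc_surj n)).

Lemma uncodeK {T} {cT : coded T} : cancel (@uncode T cT) enc.
Proof. by move=> n; rewrite /uncode; case: cid. Qed.

Lemma encK {T} {cT : coded T} : cancel enc (@uncode T cT).
Proof. by move=> x; apply: enc_inj; rewrite uncodeK. Qed.

(** Decoding does nothing to the underlying number, so the program for [F] also computes the decoded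
    value. *)
Lemma rec_uncode {S T T'} {cT : coded T} {cT' : coded T'}
    (F : set nat -> T -> nat) :
  recursive S F -> recursive S (fun A x => uncode (F A x) : T').
Proof. by apply: rec_recode => A x; rewrite uncodeK. Qed.

Lemma arithf_uncode {A T T'} {cT : coded T} {cT' : coded T'} (f : T -> nat) :
  arithf A f -> arithf A (fun x => uncode (f x) : T').
Proof. by move=> [k rf]; exists k; apply: rec_uncode. Qed.

Lemma phi_fun e x y y' : phi e x y -> phi e x y' -> y = y'.
Proof. by move=> [p [<- pxy]] /phi_relE; apply: sem_fun pxy. Qed.

(** The predecessor accounts for the shift of the denominator in [thr], which [rat_code] does not
    make. *)
Definition code_thr (r : nat) : nat * nat :=
  ((uncode r : nat * nat).1, (uncode r : nat * nat).2.-1).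

Lemma code_thr_rat_code r : code_thr (rat_code r) = rat_thr r.
Proof.
rewrite /code_thr (_ : uncode (rat_code r) = (`|numq r|, `|denq r|)%N) //.
by apply: enc_inj; rewrite uncodeK.
Qed.

(** Only pairs in lowest terms with a positive denominator code a rational; this is tested by
    encoding the value again. *)
Definition valid_rat (r : nat) : Prop := r = rat_code (rq (code_thr r)).

Lemma valid_rat_code (r : rat) : (0 <= r)%R -> valid_rat (rat_code r).
Proof. by move=> r_ge0; rewrite /valid_rat code_thr_rat_code rat_thrK. Qed.

(** * Basic cones read off their codes *)

Section Cones.
Local Open Scope ring_scope.
Context {R : realType} {U : metricType R}.
Variables (q : nat -> U) (L : signature).

Let ratr1 : ratr 1 = 1 :> R. Proof. exact: rmorph1. Qed.

Definition valid_args (j : nat) (s : seq nat) : Prop :=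
  is_symbol L j /\ size s = arity L j.

(* Number versions of [Defs.basic] and [Defs.cone]: the predicates read the
   components off the code, and v stands for the values of a structure. *)
Let bcode := (nat * (nat * (seq nat * nat)))%type.
Let ccode := (nat * (nat * seq nat))%type.

Definition bcompl x := (uncode x : bcode).1.
Definition bsymb x := (uncode x : bcode).2.1.
Definition bargs x := (uncode x : bcode).2.2.1.
Definition brat x := code_thr (uncode x : bcode).2.2.2.

Definition valid_basic (x : nat) : Prop :=
  (bcompl x <= 1)%N /\ valid_args (bsymb x) (bargs x) /\
  valid_rat (uncode x : bcode).2.2.2 /\ thr (brat x) <= 1 :> R.

Definition basic_num_val (v : nat -> seq nat -> R) (x : nat) : R :=
  if `[<bcompl x = 0%N>] then `|v (bsymb x) (bargs x) - thr (brat x)|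
  else Num.max (1 - `|v (bsymb x) (bargs x) - thr (brat x)|) 0.

Definition cabove z := (uncode z : ccode).1.
Definition crat z := code_thr (uncode z : ccode).2.1.
Definition cterms z := (uncode z : ccode).2.2.

Definition valid_cone (z : nat) : Prop :=
  (cabove z <= 1)%N /\ cterms z <> [::] /\
  (forall x, x \in cterms z -> valid_basic x) /\
  valid_rat (uncode z : ccode).2.1 /\ thr (0, 0)%N < thr (crat z) :> R /\
  thr (crat z) <= 1 :> R.

(** The maximum is unfolded: being below the threshold concerns all terms, being above it some term.
    As the threshold is positive, the initial value 0 of the iterated maximum affects neither
    case. *)
Definition in_cone_num (v : nat -> seq nat -> R) (z : nat) : Prop :=
  valid_cone z /\
  (cabove z = 0%N ->
    forall x, x \in cterms z -> basic_num_val v x < thr (crat z)) /\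
  (cabove z = 1%N ->
    exists x, x \in cterms z /\ thr (crat z) < basic_num_val v x).

(* Nothing is required of v outside the valid arguments. *)
Definition values_of (M : lstructure U L) (v : nat -> seq nat -> R) : Prop :=
  forall (j : symbol L) (s : (ar j).-tuple nat),
    v (sval j) s = interp M (map_tuple q s).

Lemma values_of_exist M : exists v, values_of M v.
Proof.
pose v j s := xget 0 [set r | exists (js : symbol L) (t : (ar js).-tuple nat),
  [/\ sval js = j, tval t = s & r = interp M (map_tuple q t)]].
exists v => j s; rewrite /v; case: xgetP => [_ -> [j' [s' [jj' ss' ->]]]|h].
  have {}jj' : j' = j by apply: val_inj.
  by subst j'; have -> : s' = s by apply: val_inj.
by have [] := h (interp M (map_tuple q s)); exists j, s.
Qed.

Lemma valid_argsP j s : valid_args j s ->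
  exists (js : symbol L) (t : (ar js).-tuple nat), sval js = j /\ tval t = s.
Proof.
move=> [symb_j /eqP size_s].
by exists (exist _ j symb_j), (Tuple size_s).
Qed.

Lemma bigmax_seq_lt (I : Type) (s : seq I) (F : I -> R) r :
  (\big[Num.max/0]_(i <- s) F i < r) = (0 < r) && all (fun i => F i < r) s.
Proof.
elim: s => [|i s IHs]; first by rewrite big_nil andbT.
by rewrite big_cons gt_max IHs /= andbCA.
Qed.

Lemma bigmax_seq_gt (I : Type) (s : seq I) (F : I -> R) r : 0 <= r ->
  (r < \big[Num.max/0]_(i <- s) F i) = has (fun i => r < F i) s.
Proof.
move=> r_ge0; elim: s => [|i s IHs]; first by rewrite big_nil ltNge r_ge0.
by rewrite big_cons lt_max IHs.
Qed.

Lemma basic_codeE (b : basic L) : basic_code b =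
  enc ((basic_compl b : nat, (sval (basic_symbol b),
    (tval (basic_args b), rat_code (basic_rat b)))) : bcode).
Proof. by rewrite !enc_pairE enc_seq_nat. Qed.

Lemma cone_codeE (c : cone L) : cone_code c =
  enc ((cone_above c : nat, (rat_code (cone_rat c),
    [seq basic_code b | b <- cone_terms c])) : ccode).
Proof. by rewrite !enc_pairE enc_seq_nat. Qed.

Lemma valid_basic_code (b : basic L) : valid_basic (basic_code b).
Proof.
have /andP[r_ge0 r_le1] := basic_rat_range b.
rewrite /valid_basic /bcompl /bsymb /bargs /brat basic_codeE encK /=.
split; first by case: (basic_compl b).
split; first by split; [exact: (svalP (basic_symbol b)) | rewrite size_tuple].
rewrite code_thr_rat_code rat_thrE // -ratr1 ler_rat r_le1.
by split; first exact: valid_rat_code.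
Qed.

Lemma basic_codeP x : valid_basic x -> exists b : basic L, basic_code b = x.
Proof.
case=> c_le1 [/valid_argsP[j [s [jE sE]]] [rE r_le1]].
have r_range : 0 <= rq (brat x) <= 1.
  by rewrite rq_ge0 -(ler_rat R) ratr1 ratr_rq.
exists (@Basic L (bcompl x == 1)%N j s (rq (brat x)) r_range).
rewrite basic_codeE -[RHS](uncodeK (T := bcode)).
apply: (congr1 (@enc bcode _)); rewrite /= jE sE.
rewrite [RHS]surjective_pairing [(uncode x : bcode).2]surjective_pairing.
rewrite [(uncode x : bcode).2.2]surjective_pairing -rE.
congr (_, _); rewrite -/(bcompl x).
by move: c_le1; case: (bcompl x) => [|[]].
Qed.

Lemma basic_num_valE M v (b : basic L) : values_of M v ->
  basic_num_val v (basic_code b) = basic_val q b M.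
Proof.
move=> Mv; have /andP[r_ge0 _] := basic_rat_range b.
rewrite /basic_num_val /bcompl /bsymb /bargs /brat basic_codeE encK /= Mv.
rewrite code_thr_rat_code rat_thrE // /basic_val.
by case: (basic_compl b); case: asboolP.
Qed.

Lemma Sat_in_cone_num M v z : values_of M v ->
  Sat q M z <-> in_cone_num v z.
Proof.
move=> Mv; split=> [[c <- cM]|[vz [ltz gtz]]].
  have /andP[r_gt0 r_le1] := cone_rat_range c.
  have cE : (cabove (cone_code c) = cone_above c) *
    (cterms (cone_code c) = [seq basic_code b | b <- cone_terms c]) *
    ((uncode (cone_code c) : ccode).2.1 = rat_code (cone_rat c)) *
    (thr (crat (cone_code c)) = ratr (cone_rat c) :> R).
    rewrite /cabove /cterms /crat cone_codeE encK /=.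
    by rewrite code_thr_rat_code rat_thrE // ltW.
  rewrite /in_cone_num /valid_cone !cE thr0; split; last split.
  - split; first by case: (cone_above c).
    split; first by have := cone_terms_nonempty c; case: (cone_terms c).
    split; last by rewrite ltr0q -ratr1 ler_rat; split=> //; exact/valid_rat_code/ltW.
    move=> x; elim: (cone_terms c) => //= b bs IHbs; rewrite inE => /orP[/eqP->|] //.
    exact: valid_basic_code.
  - move: cM; rewrite /in_cone; case: (cone_above c) => //.
    rewrite bigmax_seq_lt => /andP[_ allb] _ x xb.
    have /allP/(_ x xb) : all (fun x => basic_num_val v x < ratr (cone_rat c))
        [seq basic_code b | b <- cone_terms c].
      by rewrite all_map; apply: sub_all allb => b /=; rewrite (basic_num_valE _ Mv).
    by [].
  - move: cM; rewrite /in_cone; case: (cone_above c) => //.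
    rewrite bigmax_seq_gt ?ler0q ?ltW // => hasb _.
    have /hasP[x xb vx] : has (fun x => ratr (cone_rat c) < basic_num_val v x)
        [seq basic_code b | b <- cone_terms c].
      by rewrite has_map; apply: sub_has hasb => b /=; rewrite (basic_num_valE _ Mv).
    by exists x.
have [a_le1 [nonempty [basics [rE [r_gt0 r_le1]]]]] := vz.
have [bs bsE] : exists bs : seq (basic L), [seq basic_code b | b <- bs] = cterms z.
  elim: (cterms z) basics => [|x l IHl] basics; first by exists [::].
  have [|bs bsE] := IHl; first by move=> y yl; apply: basics; rewrite inE yl orbT.
  have [b bE] := basic_codeP (basics _ (mem_head x l)).
  by exists (b :: bs); rewrite /= bE bsE.
have bs_gt0 : (0 < size bs)%N.
  by rewrite -(size_map (@basic_code L)) bsE; case: (cterms z) nonempty.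
have r_range : 0 < rq (crat z) <= 1.
  by rewrite -(ltr0q R) -(ler_rat R) ratr1 ratr_rq r_le1 -thr0 r_gt0.
exists (@Cone L (cabove z == 1)%N bs bs_gt0 (rq (crat z)) r_range).
  rewrite cone_codeE -[RHS](uncodeK (T := ccode)).
  apply: (congr1 (@enc ccode _)); rewrite /= bsE [RHS]surjective_pairing [(uncode z : ccode).2]surjective_pairing -rE.
  congr (_, _); rewrite -/(cabove z).
  by move: a_le1; case: (cabove z) => [|[]].
rewrite /in_cone /= /grey_val /= ratr_rq.
case: eqP => [/gtz[x [+ vx]]|/eqP a1].
  rewrite bigmax_seq_gt ?thr_ge0 // -bsE => xb.
  have : has (fun x => thr (crat z) < basic_num_val v x)
      [seq basic_code b | b <- bs] by apply/hasP; exists x.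
  by rewrite has_map; apply: sub_has => b /=; rewrite (basic_num_valE _ Mv).
have /ltz : cabove z = 0%N by move: a_le1 a1; case: (cabove z) => [|[]].
rewrite bigmax_seq_lt -thr0 r_gt0 /= -bsE => /allP.
by rewrite all_map; apply: sub_all => b /=; rewrite (basic_num_valE _ Mv).
Qed.

End Cones.

(** * The values of a structure recovered from its index *)

Section Indices.
Local Open Scope ring_scope.
Context {R : realType} {U : metricType R}.
Variables (q : nat -> U) (L : signature).

(* The code of the cone |R_j(s) - 0| < d. *)
Definition lt_code (j : nat) (s : seq nat) (d : nat * nat) : nat :=
  enc (0%N, (rat_code (rq d),
    [:: enc (0%N, (j, (s, rat_code (rq (0, 0)%N))))])).

(** Cones only have thresholds in the interval from 0, excluded, to 1. Larger thresholds are put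
    into the cut by hand, which also keeps it nonempty whatever [e] is. *)
Definition index_cut (e j : nat) (s : seq nat) (d : nat * nat) : Prop :=
  thr (1, 0)%N < thr d :> R \/
  (thr (0, 0)%N < thr d :> R /\ phi e (lt_code j s d) 1).

(* The value of R_j(s) in the structure with index e, if there is one. *)
Definition index_val (e j : nat) (s : seq nat) : R :=
  inf [set thr d | d in index_cut e j s].

Let cut2 e j s : [set thr d | d in index_cut e j s] (thr (2, 0)%N : R).
Proof. by exists (2, 0)%N => //; left; rewrite thr_lt. Qed.

Let cut_lb e j s : lbound [set thr d | d in index_cut e j s] (0 : R).
Proof. by move=> _ [d _ <-]; apply: thr_ge0. Qed.

Lemma index_val_lt e j s d : index_val e j s < thr d <->
  exists c, index_cut e j s c /\ thr c < thr d :> R.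
Proof.
split=> [/inf_lt[|_ [c ec <-] cd]|[c [ec]]]; first by eexists; exact: cut2.
  by exists c.
by apply: le_lt_trans; apply: ge_inf; [eexists; exact: cut_lb | exists c].
Qed.

Lemma index_val_range e j s : 0 <= index_val e j s <= 1.
Proof.
apply/andP; split; first by apply: lb_le_inf; [eexists; exact: cut2 | exact: cut_lb].
rewrite leNgt; apply/negP => /(thr_between ler01)[d d1 dV].
have : index_val e j s <= thr d; last by rewrite leNgt dV.
apply: ge_inf; first by eexists; exact: cut_lb.
by exists d => //; left; rewrite thr_nat.
Qed.

Lemma lt_code_in_cone (v : nat -> seq nat -> R) j s d : valid_args L j s -> 0 <= v j s ->
  0 < thr d :> R -> thr d <= 1 :> R ->
  in_cone_num L v (lt_code j s d) <-> v j s < thr d.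
Proof.
move=> vjs v_ge0 d_gt0 d_le1.
have zE : (cabove (lt_code j s d) = 0%N) *
    (cterms (lt_code j s d) = [:: enc (0%N, (j, (s, rat_code (rq (0, 0)%N))))]) *
    (crat (lt_code j s d) = rat_thr (rq d)).
  by rewrite /cabove /cterms /crat /lt_code encK /= code_thr_rat_code.
set x := enc _ in zE.
have xE : (bcompl x = 0%N) * (bsymb x = j) * (bargs x = s) *
    (thr (brat x) = 0 :> R).
  rewrite /bcompl /bsymb /bargs /brat /x encK /= code_thr_rat_code.
  by rewrite rat_thrE ?rq_ge0 // ratr_rq thr0.
have dE : thr (rat_thr (rq d)) = thr d :> R by rewrite rat_thrE ?rq_ge0 // ratr_rq.
have vx : basic_num_val v x = v j s.
  by rewrite /basic_num_val !xE; case: asboolP => // _; rewrite subr0 ger0_norm.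
split=> [[_ [+ _]]|vd].
  by rewrite !zE dE => /(_ erefl x (mem_head _ _)); rewrite vx.
rewrite /in_cone_num !zE dE; split; last first.
  by split=> // _ y; rewrite inE => /eqP->; rewrite vx.
rewrite /valid_cone !zE dE thr0; do 2 split=> //; split; last first.
  split=> //; rewrite /lt_code encK; exact/valid_rat_code/rq_ge0.
move=> y; rewrite inE => /eqP->; rewrite /valid_basic !xE ler01.
do 2 split=> //; split=> //; rewrite /x encK; exact/valid_rat_code/rq_ge0.
Qed.

Lemma index_of_phi (M : lstructure U L) e z :
  index_of q M e -> phi e z 1 <-> Sat q M z.
Proof.
move=> eM; have [ez nez] := eM z; split=> // e1.
by apply: contrapT => /nez /phi_fun-/(_ _ e1).
Qed.

Lemma index_val_values (M : lstructure U L) e :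
  index_of q M e -> values_of q M (index_val e).
Proof.
move=> eM j s; have [v Mv] := values_of_exist q M.
have vjs : valid_args L (sval j) s.
  by split; [exact: (svalP j) | rewrite size_tuple].
have /andP[v_ge0 v_le1] := interp_range M (map_tuple q s).
have cutE d : index_cut e (sval j) s d <-> v (sval j) s < thr d.
  rewrite /index_cut (index_of_phi _ eM) (Sat_in_cone_num _ Mv) thr0 thr_nat.
  have [d_gt1|d_le1] := ltP 1 (thr d).
    by split=> // _; [rewrite Mv (le_lt_trans v_le1) | left].
  have [d_gt0|d_le0] := ltP 0 (thr d).
    rewrite -(lt_code_in_cone vjs) ?Mv //; split=> [[|[]] //|?]; by right.
  split=> [[|[]] //|]; rewrite Mv => /(le_lt_trans v_ge0).
  by rewrite ltNge d_le0.
rewrite -Mv; apply/eqP; rewrite eq_le; apply/andP; split.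
  rewrite leNgt; apply/negP => /thr_between[|d vd dI]; first by rewrite Mv.
  suff : index_val e (sval j) s <= thr d by rewrite leNgt dI.
  by apply: ge_inf; [eexists; exact: cut_lb | exists d => //; apply/cutE].
apply: lb_le_inf => [|_ [d /cutE/ltW vd <-]] //; by eexists; exact: cut2.
Qed.

Definition lipschitz_values (v : nat -> seq nat -> R) : Prop :=
  forall j s t i, valid_args L j s -> valid_args L j t -> (i < size s)%N ->
    (forall k, (k < size s)%N -> k <> i -> nth 0%N s k = nth 0%N t k) ->
    v j s <= v j t + qdist q (nth 0%N s i) (nth 0%N t i).

Definition structure_index (e : nat) : Prop :=
  (forall z, phi e z 0 \/ phi e z 1) /\
  (forall z, phi e z 1 <-> in_cone_num L (index_val e) z) /\
  lipschitz_values (index_val e).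

Lemma structure_indexP e :
  structure_index e <-> exists M : lstructure U L, index_of q M e.
Proof.
split=> [[etot [eP elip]]|[M eM]].
  have w_range (j : symbol L) (s : (ar j).-tuple nat) :
    0 <= index_val e (sval j) s <= 1 by apply: index_val_range.
  have vt (j : symbol L) (s : (ar j).-tuple nat) : valid_args L (sval j) s.
    by split; [exact: (svalP j) | rewrite size_tuple].
  have [|M MP] := mcshane_extension (q := q) w_range.
    move=> j i s t st; have := elip (sval j) s t i (vt j s) (vt j t).
    rewrite size_tuple -!tnth_nth => /(_ (ltn_ord i)); apply=> k lt_k nk.
    rewrite -(tnth_nth _ s (Ordinal lt_k)) -(tnth_nth _ t (Ordinal lt_k)).
    by apply: st; apply/eqP => ki; apply: nk; rewrite -ki.
  exists M => z; have Mv : values_of q M (index_val e) by move=> j s; rewrite MP.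
  split=> [/(Sat_in_cone_num _ Mv)/eP //|nMz].
  by case: (etot z) => // /eP/(Sat_in_cone_num _ Mv).
have Mv := index_val_values eM; split; last split.
- by move=> z; have [Mz nMz] := eM z; have [/Mz|/nMz] := pselect (Sat q M z);
    [right | left].
- by move=> z; rewrite (index_of_phi _ eM) (Sat_in_cone_num _ Mv).
- move=> j s t i /valid_argsP[js [s' [<- <-]]] [_ tsize] i_lt st.
  have {}tsize : size t == ar js by apply/eqP.
  rewrite -[t]/(tval (Tuple tsize)) !Mv -lerBlDl.
  have lt_i : (i < ar js)%N by rewrite -(size_tuple s').
  have := interp_lipschitz (i := Ordinal lt_i) (x := map_tuple q s')
    (y := map_tuple q (Tuple tsize)) M.
  rewrite !tnth_map /qdist !(tnth_nth 0%N) /= => h.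
  apply: le_trans (ler_norm _) _; apply: le_trans (h _) _ => //.
  move=> k nk; rewrite !tnth_map; congr q; rewrite !(tnth_nth 0%N) /= st //.
    by rewrite size_tuple.
  by move=> ki; case/eqP: nk; apply: val_inj.
Qed.

End Indices.

(** * Being the index of a structure is arithmetical *)

Lemma arithf_code_thr {A T} {cT : coded T} (f : T -> nat) :
  arithf A f -> arithf A (fun x => code_thr (f x)).
Proof.
move=> rf; have rd := arithf_uncode (T' := nat * nat) rf.
by apply: arithf_pair; [apply: arithf_fst | apply/arithf_pred/arithf_snd].
Qed.

Lemma arith_phi_app {T} {cT : coded T} (e x y : T -> nat) :
  arithf set0 e -> arithf set0 x -> arithf set0 y ->
  arith set0 (fun t => phi (e t) (x t) (y t)).
Proof.
move=> re rx ry.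
exact: (arith_comp arith_phi (arithf_pair re (arithf_pair rx ry))).
Qed.

Lemma arith_valid_args {T} {cT : coded T} (L : signature) (j : T -> nat)
    (s : T -> seq nat) : computable_signature L ->
  arithf set0 j -> arithf set0 s ->
  arith set0 (fun t => valid_args L (j t) (s t)).
Proof.
move=> [/arith_computable symbL [e eP]] rj rs.
have : arith set0 (fun t => is_symbol L (j t) /\ phi e (j t) (size (s t))).
  apply: arith_and; first exact: (arith_comp symbL).
  by apply: arith_phi_app; arith.
apply: arith_ext => t; rewrite /valid_args.
by split=> -[symb] => [/(phi_fun (eP _ symb))|->]; [|split=> //; exact: eP].
Qed.

Lemma arith_thr_le1 {R : realType} {A T} {cT : coded T} (d : T -> nat * nat) :
  arithf A d -> arith A (fun x => thr (d x) <= 1 :> R)%R.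
Proof.
move=> rd; have := @arith_thr_le R A T _ d _ rd (arithf_const (1, 0)).
by apply: arith_ext => x; rewrite thr_nat.
Qed.

Ltac arith_leaf ::= match goal with
  | |- arith _ (fun x => phi _ _ _) => apply: arith_phi_app
  | |- arith _ (fun x => valid_args _ _ _) => apply: arith_valid_args => //
  | |- arith _ (fun x => is_true (thr _ < thr _)%R) => apply: arith_thr_lt
  | |- arith _ (fun x => is_true (thr _ <= thr _)%R) => apply: arith_thr_le
  | |- arith _ (fun x => is_true (thr _ <= 1)%R) => apply: arith_thr_le1
  | |- arithf _ (fun x => enc _) => apply: arithf_enc
  | |- arithf _ (fun x => uncode _) => apply: arithf_uncode
  | |- arithf _ (fun x => rat_code (rq _)) => apply: arithf_rat_code
  | |- arithf _ (fun x => code_thr _) => apply: arithf_code_thr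
  | |- arithf _ (fun x => addt _ _) => apply: arithf_addt
  end.

Section ArithIndices.
Local Open Scope ring_scope.
Context {R : realType} {U : metricType R}.
Variables (q : nat -> U) (L : signature).
Hypothesis comp_L : computable_signature L.

Lemma seq_code_inj : injective seq_code.
Proof. by move=> s t; rewrite -!enc_seq_nat; apply: enc_inj. Qed.

Lemma rat_code_inj (r s : rat) : 0 <= r -> 0 <= s -> rat_code r = rat_code s -> r = s.
Proof.
by move=> r0 s0 rs; rewrite -(rat_thrK r0) -(rat_thrK s0) -!code_thr_rat_code rs.
Qed.

(** A strict upper cut of the distance is the negation of an atomic formula [FoGe]. Thresholds above
    1 admit no such formula, but they exceed every distance. *)
Lemma arithr_qdist {T} {cT : coded T} (f g : T -> nat) :
  decidable_presentation q -> (forall m n, qdist q m n <= 1) ->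
  arithf set0 f -> arithf set0 g ->
  @arithr R set0 _ _ (fun x => qdist q (f x) (g x)).
Proof.
move=> /arith_computable; set D := [set z | _] => arithD dist_le1 rf rg.
(* The code of the formula that bounds the distance of variables 0 and 1 below by [rq d], paired
   with the assignment of [m] and [n] to them. *)
pose code d m n := pair_code (pair_code 1 (pair_code (rat_code (rq d)) (pair_code 0 1)))
  (seq_code [:: m; n]).
have DE d m n : thr d <= 1 :> R -> D (code d m n) <-> thr d <= qdist q m n.
  move=> d_le1; have rd : 0 <= rq d <= 1.
    by rewrite rq_ge0 -(ler_rat R) ratr_rq (rmorph1 (ratr : rat -> R)).
  split=> [[f' [l [/pair_code_inj[+ /seq_code_inj<-]]]]|dq].
    case: f' => //= [r r01 i j|r r01 i j|f'|f' g'|i f'] /pair_code_inj[] //.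
    move=> _ /pair_code_inj[dr /pair_code_inj[<- <-]] /=.
    rewrite -(rat_code_inj _ _ dr) ?rq_ge0 ?ratr_rq //.
    by case/andP: r01.
  by exists (FoGe rd 0 1), [:: m; n]; split=> //=; rewrite ratr_rq.
have : arith set0 (fun z : T * (nat * nat) => thr (1, 0)%N < thr z.2 :> R \/
    (thr z.2 <= thr (1, 0)%N :> R /\ ~ D (code z.2 (f z.1) (g z.1)))).
  have rf1 : arithf set0 (fun z : T * (nat * nat) => f z.1).
    by apply: (arithf_comp rf); arith.
  have rg1 : arithf set0 (fun z : T * (nat * nat) => g z.1).
    by apply: (arithf_comp rg); arith.
  apply: arith_or; first by arith.
  apply: arith_and; first by arith.
  apply: arith_not; apply: (arith_comp arithD); rewrite /code.
  apply: arithf_pair_code; first by arith.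
  have := arithf_enc (arithf_cons rf1 (arithf_cons rg1 (arithf_const [::]))).
  by under eq_fun do rewrite enc_seq_nat.
apply: arith_ext => -[x d] /=; rewrite thr_nat.
have [d_gt1|d_le1] := ltP 1 (thr d).
  by split=> // _; [apply: le_lt_trans d_gt1 | left].
rewrite DE //; split=> [[] // [_ /negP]|]; first by rewrite -ltNge.
by move=> qd; right; split=> //; apply/negP; rewrite -ltNge.
Qed.

Lemma arithf_lt_code {T} {cT : coded T} j s d :
  arithf set0 j -> arithf set0 s -> arithf set0 d ->
  arithf set0 (fun x : T => lt_code (j x) (s x) (d x)).
Proof.
move=> rj rs rd; apply: arithf_enc; apply: arithf_pair; first by arith.
apply: arithf_pair; first by arith.
apply: arithf_cons; last by arith.
by apply: arithf_enc; arith.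
Qed.

Lemma arithr_index_val {T} {cT : coded T} e j s :
  arithf set0 e -> arithf set0 j -> arithf set0 s ->
  arithr (A := set0) (fun x : T => index_val (e x) (j x) (s x) : R).
Proof.
move=> re rj rs.
apply: (arithr_comp (h := fun z : nat * (nat * seq nat) =>
  index_val z.1 z.2.1 z.2.2 : R) (u := fun x => (e x, (j x, s x))));
  last by arith.
have : arith set0 (fun z : (nat * (nat * seq nat)) * (nat * nat) =>
    exists c, index_cut (R := R) z.1.1 z.1.2.1 z.1.2.2 c /\ thr c < thr z.2 :> R).
  apply: arith_ex; apply: arith_and; last by arith.
  apply: arith_or; first by arith.
  apply: arith_and; first by arith.
  by apply: arith_phi_app; [arith|apply: arithf_lt_code; arith|arith].
by apply: arith_ext => z; rewrite index_val_lt.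
Qed.

Lemma index_val_ge0 e j s : 0 <= index_val e j s :> R.
Proof. by have /andP[] := @index_val_range R e j s. Qed.

Lemma arith_valid_basic {T} {cT : coded T} (x : T -> nat) :
  arithf set0 x -> arith set0 (fun t => valid_basic (R := R) L (x t)).
Proof.
by move=> rx; rewrite /valid_basic /bcompl /bsymb /bargs /brat /valid_rat; arith.
Qed.

Lemma arithr_basic_num_val {T} {cT : coded T} (e x : T -> nat) :
  arithf set0 e -> arithf set0 x ->
  arithr (A := set0) (fun t => basic_num_val (index_val (e t)) (x t) : R).
Proof.
move=> re rx; rewrite /basic_num_val /bcompl /bsymb /bargs /brat.
have rd : arithr (A := set0) (fun t => `|index_val (e t)
    (uncode (x t) : nat * (nat * (seq nat * nat))).2.1
    (uncode (x t) : nat * (nat * (seq nat * nat))).2.2.1 -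
    thr (code_thr (uncode (x t) : nat * (nat * (seq nat * nat))).2.2.2)| : R).
  apply: arithr_dist => [t|t||]; rewrite ?index_val_ge0 ?thr_ge0 //.
    by apply: arithr_index_val; arith.
  by apply: arithr_thr; arith.
apply: arithr_if; [by arith | exact: rd |].
apply: arithr_subt => [t|t||]; [exact: ler01 | exact: normr_ge0 | | exact: rd].
apply: (arithr_ext (f := fun=> thr (1, 0)%N)) => [t|]; first exact: thr_nat.
by apply: arithr_thr; arith.
Qed.

Lemma arith_in_cone_num :
  arith set0 (fun z : nat * nat => in_cone_num L (index_val z.1 : _ -> _ -> R) z.2).
Proof.
rewrite /in_cone_num /valid_cone /cabove /crat /cterms /valid_rat.
apply: arith_and.
  apply: arith_and; first by arith.
  apply: arith_and; first by arith.
  apply: arith_and; last by arith.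
  by apply: arith_all; apply: arith_imp; [arith | apply: arith_valid_basic; arith].
apply: arith_and; apply: arith_imp.
- by arith.
- apply: arith_all; apply: arith_imp; first by arith.
  by apply: arith_lt_thr; [apply: arithr_basic_num_val|]; arith.
- by arith.
- apply: arith_ex; apply: arith_and; first by arith.
  apply: arith_lt => [t||]; first exact: thr_ge0.
    by apply: arithr_thr; arith.
  by apply: arithr_basic_num_val; arith.
Qed.

Lemma qdist_ge0 m n : 0 <= qdist q m n.
Proof. exact: mdist_ge0. Qed.

Lemma arith_structure_index :
  decidable_presentation q -> (forall m n, qdist q m n <= 1) ->
  arith set0 (fun e => structure_index q L e).
Proof.
move=> dec_q dist_le1; rewrite /structure_index /lipschitz_values.
apply: arith_and; first by arith.
apply: arith_and.
  apply: arith_all; apply: arith_iff; first by arith.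
  exact: arith_in_cone_num.
do 4 apply: arith_all; do 4 (apply: arith_imp; first by arith).
apply: arith_le => [t||].
- by rewrite addr_ge0 ?index_val_ge0 ?qdist_ge0.
- by apply: arithr_index_val; arith.
- apply: arithr_add => [t|t||]; rewrite ?index_val_ge0 ?qdist_ge0 //.
    by apply: arithr_index_val; arith.
  by apply: arithr_qdist => //; arith.
Qed.

End ArithIndices.

(** * Coded formulas and the cuts of their values *)

Lemma arithf_rev {A T} {cT : coded T} (f : T -> seq nat) :
  arithf A f -> arithf A (fun x => rev (f x)).
Proof.
apply: (arithf_comp (g := @rev nat)); apply: arithf_graph.
have : arith A (fun z : seq nat * seq nat => size z.2 = size z.1 /\
    forall i, i < size z.1 -> nth 0 z.2 i = nth 0 z.1 (size z.1 - i.+1)) by arith.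
apply: arith_ext => -[s t] /=; split=> [[sz eq_nth]|->].
  apply: (@eq_from_nth _ 0) => [|i]; rewrite ?size_rev // sz => lt_i.
  by rewrite nth_rev ?eq_nth.
by rewrite size_rev; split=> // i lt_i; rewrite nth_rev.
Qed.

Local Arguments enc {T _} _ : simpl never.

Section CodedFormulas.
Local Open Scope ring_scope.
Context {R : realType} {U : metricType R}.
Variables (q : nat -> U) (L : signature).

(* Every number codes a formula, given a bound k on its depth; the free
   variables are read from the right end of the list s, so that a quantifier
   adds an element at its head. *)
Definition atom_val (v : nat -> seq nat -> R) (a : nat) (s : seq nat) : R :=
  let b := uncode a : nat * (nat * seq nat) in
  if `[<b.1 = 0%N>] then 1
  else if `[<b.1 = 1%N>] then
    if `[<(nth 0%N b.2.2 0 < size s)%N /\ (nth 0%N b.2.2 1 < size s)%N>]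
    then qdist q (nth 0%N (rev s) (nth 0%N b.2.2 0))
           (nth 0%N (rev s) (nth 0%N b.2.2 1))
    else 0
  else if `[<valid_args L b.2.1 b.2.2 /\ forall i, i \in b.2.2 -> (i < size s)%N>]
    then v b.2.1 [seq nth 0%N (rev s) i | i <- b.2.2]
  else 0.

Section Values.
Variable atom : nat -> seq nat -> R.

(** Up to equality of values, truncated difference, positive scaling and infimum generate all
    connectives and quantifiers from the atoms, among them the constant 1. The tag 0 passes the same
    code to the next lower level: this padding lets an atom occur at any depth. *)
Fixpoint code_val (k : nat) (u : nat) (s : seq nat) {struct k} : R :=
  match k with
  | 0%N => atom (uncode u : nat * nat).2 s
  | k'.+1 =>
    let arg := (uncode u : nat * nat).2 in
    match (uncode u : nat * nat).1 with
    | 0%N => code_val k' u s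
    | 1%N => Num.max (code_val k' (uncode arg : nat * nat).1 s -
                    code_val k' (uncode arg : nat * nat).2 s) 0
    | 2%N => let b := uncode arg : nat * (nat * nat) in
             Num.min (thr (b.1.+1, b.2.1)%N * code_val k' b.2.2 s) 1
    | _ => inf (range (fun x => code_val k' arg (x :: s)))
    end
  end.

Hypothesis atom_range : forall a s, 0 <= atom a s <= 1.

Lemma code_val_range k u s : 0 <= code_val k u s <= 1.
Proof.
have subt_range (x y : R) : 0 <= x <= 1 -> 0 <= y <= 1 -> 0 <= Num.max (x - y) 0 <= 1.
  by move=> /andP[? ?] /andP[? ?]; rewrite le_max lexx orbT ge_max ler01 andbT; lra.
elim: k u s => [|k IHk] u s /=; first exact: atom_range.
case: (uncode u).1 => [|[|[|n]]] //.
- exact: subt_range (IHk _ _) (IHk _ _).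
- have k_ge0 u' : 0 <= code_val k u' s by case/andP: (IHk u' s).
  by rewrite ge_min lexx orbT andbT le_min ler01 andbT mulr_ge0 ?thr_ge0.
- set f := fun x => _; have f_range x : 0 <= f x <= 1 by apply: IHk.
  apply/andP; split.
    apply: lb_le_inf => [|_ [x _ <-]]; first by exists (f 0%N); exists 0%N.
    by case/andP: (f_range x).
  apply: le_trans (_ : f 0%N <= 1); last by case/andP: (f_range 0%N).
  apply: ge_inf; last by exists 0%N.
  by exists 0 => _ [x _ <-]; case/andP: (f_range x).
Qed.

Lemma code_val_ge0 k u s : 0 <= code_val k u s.
Proof. by case/andP: (code_val_range k u s). Qed.

End Values.

Hypothesis comp_L : computable_signature L.
Hypothesis dec_q : decidable_presentation q.
Hypothesis dist_le1 : forall m n, qdist q m n <= 1.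

Notation iatom e := (atom_val (index_val e)).

Lemma iatom_range e a s : 0 <= iatom e a s <= 1.
Proof.
rewrite /atom_val; case: asboolP => _; first by rewrite ler01 lexx.
case: asboolP => _; case: asboolP => _; rewrite ?lexx ?ler01 //.
  by rewrite qdist_ge0 dist_le1.
exact: index_val_range.
Qed.

Lemma arithr_iatom {T} {cT : coded T} (e a : T -> nat) (s : T -> seq nat) :
  arithf set0 e -> arithf set0 a -> arithf set0 s ->
  arithr (A := set0) (fun x => iatom (e x) (a x) (s x)).
Proof.
move=> re ra rs; rewrite /atom_val; cbv zeta.
have rr := arithf_rev rs.
have r0 : arithr (A := set0) (fun=> 0 : R) :> Prop.
  by apply: (arithr_ext (f := fun _ : T => thr (0, 0)%N)) => [t|];
    [exact: thr0 | apply: arithr_thr; arith].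
have r1 : arithr (A := set0) (fun=> 1 : R) :> Prop.
  by apply: (arithr_ext (f := fun _ : T => thr (1, 0)%N)) => [t|];
    [exact: thr_nat | apply: arithr_thr; arith].
apply: arithr_if; [by arith| exact: r1 |].
apply: arithr_if; first by arith.
  apply: arithr_if; [by arith | | exact: r0].
  by apply: arithr_qdist => //; arith.
apply: arithr_if; [by arith | | exact: r0].
by apply: arithr_index_val; [| |apply: arithf_map_nth]; arith.
Qed.

Let item := (nat * (nat * (seq nat * (nat * nat))))%type.

Let below k (x : item) : Prop :=
  code_val (iatom x.1) k x.2.1 x.2.2.1 < thr x.2.2.2.

Definition divt (d c : nat * nat) : nat * nat :=
  (d.1 * c.2.+1, (d.2.+1 * c.1.+1).-1)%N.

Lemma thr_div d c : thr (divt d c) = thr d / thr (c.1.+1, c.2) :> R.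
Proof.
rewrite /thr (_ : (divt d c).2.+1 = (d.2.+1 * c.1.+1)%N); last by rewrite prednK.
by rewrite !natrM invf_div mulf_div.
Qed.

(** The witness [z.2] is the separating rational in the case of a truncated difference, and its
    first component is the chosen point in the case of an infimum; the other two cases ignore it. In
    the scaling case [d.2.+1 < d.1] says that the threshold exceeds 1, which takes care of the
    truncation. *)
Let step (A : set nat) (z : item * (nat * nat)) : Prop :=
  let: e := z.1.1 in let: u := uncode z.1.2.1 : nat * nat in
  let: s := z.1.2.2.1 in let: d := z.1.2.2.2 in
  (u.1 = 0%N /\ A (enc z.1)) \/
  ((u.1 = 1%N /\ (0 < d.1)%N /\
     A (enc ((e, ((uncode u.2 : nat * nat).1, (s, addt z.2 d))) : item)) /\
     ~ A (enc ((e, ((uncode u.2 : nat * nat).2, (s, z.2))) : item))) \/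
  ((u.1 = 2%N /\ ((d.2.+1 < d.1)%N \/
     A (enc ((e, ((uncode u.2 : nat * (nat * nat)).2.2, (s,
       divt d ((uncode u.2 : nat * (nat * nat)).1,
               (uncode u.2 : nat * (nat * nat)).2.1)))) : item)))) \/
  ((2 < u.1)%N /\ A (enc ((e, (u.2, (z.2.1 :: s, d))) : item))))).

Let belowE k (x : item) : [set enc y | y in below k] (enc x) <-> below k x.
Proof. by split=> [[y yk yx]|]; [rewrite -(enc_inj yx) | exists x]. Qed.

Let belowS k x :
  below k.+1 x <-> exists t, step [set enc y | y in below k] (x, t).
Proof.
case: x => e [u [s d]]; rewrite /step /=.
set A := [set enc y | y in below k].
have AE y : A (enc y) <-> below k y by apply: belowE.
rewrite /below /=; set at_ := iatom e.
have at_ge0 := code_val_ge0 (iatom_range e) k.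
case: (uncode u : nat * nat) => -[|[|[|n]]] arg /=.
- split=> [lt_d|[t [[_ /AE]|[[]|[[]|[]]]]]] //.
  by exists (0, 0)%N; left; split=> //; apply/AE.
- rewrite lt_subt ?thr_ge0 //; split.
    move=> [d_gt0 [t [vt wt]]]; exists t; right; left; split=> //; split.
      by move: d_gt0; rewrite -thr0 thr_lt /= mul0n muln1.
    by split=> [|/AE //]; apply/AE; rewrite /below /= thr_add.
  move=> [t [[]|[[_ [d_gt0 [/AE vt nwt]]]|[[]|[]]]]] //.
  split; first by rewrite -thr0 thr_lt /= mul0n muln1.
  by exists t; move: vt; rewrite /below /= thr_add; split=> // wt; apply/nwt/AE.
- case: (uncode arg : nat * (nat * nat)) => m [l v] /=.
  have c_gt0 : 0 < thr (m.+1, l) :> R by rewrite -thr0 thr_lt.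
  have ltE : code_val at_ k v s < thr (divt d (m, l)) <->
      thr (m.+1, l) * code_val at_ k v s < thr d.
    by rewrite thr_div /= ltr_pdivlMr // mulrC.
  have gt1E : (d.2.+1 < d.1)%N = (1 < thr d :> R).
    have <- : thr (1, 0)%N = 1 :> R by exact: thr_nat.
    by rewrite thr_lt mul1n muln1.
  rewrite gt_min; split=> [/orP lt_d|[t [[]|[[]|[[_ lt_d]|[]]]]]] //.
    exists (0, 0)%N; right; right; left; split=> //.
    by case: lt_d => [/ltE|]; [right; apply/AE | left; rewrite gt1E].
  by apply/orP; case: lt_d => [|/AE/ltE]; [rewrite gt1E; right | left].
- set f := fun x => _; split=> [/inf_lt[|_ [x _ <-] lt_d]|].
  + by exists (f 0%N); exists 0%N.
  + by exists (x, 0)%N; do 3 right; split=> //; apply/AE.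
  + move=> [[x t] [[]|[[]|[[]|[_ /AE /= lt_d]]]]] //.
    apply: le_lt_trans lt_d; apply: ge_inf; last by exists x.
    by exists 0 => _ [y _ <-]; apply: at_ge0.
Qed.

Ltac recursive_step := lazy beta; match goal with
  | |- decidable_in _ (fun A x => _ /\ _) => apply: dec_and
  | |- decidable_in _ (fun A x => _ \/ _) => apply: dec_or
  | |- decidable_in _ (fun A x => ~ _) => apply: dec_not
  | |- decidable_in _ (fun A x => @eq _ _ _) => apply: dec_eq
  | |- decidable_in _ (fun A x => is_true (leq _ _)) => apply: dec_leq
  | |- decidable_in _ (fun A x => A _) => apply: dec_oracle
  | |- recursive _ (fun A x => x) => apply: rec_id
  | |- recursive _ (fun A x => ?c) => apply: rec_const
  | |- recursive _ (fun A x => (_, _)) => apply: rec_pair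
  | |- recursive _ (fun A x => fst _) => apply: rec_fst
  | |- recursive _ (fun A x => snd _) => apply: rec_snd
  | |- recursive _ (fun A x => S _) => apply: rec_succ
  | |- recursive _ (fun A x => predn _) => apply: rec_pred
  | |- recursive _ (fun A x => addn _ _) => apply: rec_add
  | |- recursive _ (fun A x => muln _ _) => apply: rec_mul
  | |- recursive _ (fun A x => cons _ _) => apply: rec_cons
  | |- recursive _ (fun A x => enc _) => apply: rec_enc
  | |- recursive _ (fun A x => uncode _) => apply: rec_uncode
  end.

Let dec_step : decidable_in setT step.
Proof.
rewrite /step /addt /divt; cbv zeta.
by repeat recursive_step.
Qed.

Lemma arith_code_val : arith jump_omega (fun z : nat * item =>
  code_val (iatom z.2.1) z.1 z.2.2.1 z.2.2.2.1 < thr z.2.2.2.2).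
Proof.
apply: (arith_uniform_jumps (X := below)) dec_step belowS.
apply: arith_lt_thr; last by arith.
by apply: arithr_iatom; arith.
Qed.

End CodedFormulas.

(** * Formulas and codes represent the same functions *)

Section FormulaCodes.
Local Open Scope ring_scope.
Context {R : realType} {U : metricType R} {L : signature}.
Variables (q : nat -> U) (M : lstructure U L) (v : nat -> seq nat -> R).
Hypothesis mdist_le1 : forall x y : U, mdist x y <= 1.
Hypothesis dense_q : dense (range q).
Hypothesis Mv : values_of q M v.

Notation val_ := (code_val (atom_val q L v)).

(** The code must work at all sufficiently large depths, so that two subformulas of different depths
    can be evaluated at a common one. *)
Definition represented n (g : n.-tuple nat -> R) : Prop :=
  exists u k0, forall k, (k0 <= k)%N -> forall s : n.-tuple nat,
    val_ k u (rev s) = g s.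

Lemma represented_ext n (g h : n.-tuple nat -> R) :
  g =1 h -> represented g -> represented h.
Proof.
by move=> gh [u [k0 uP]]; exists u, k0 => k k0k s; rewrite uP.
Qed.

Lemma code_val_atom k a s :
  val_ k (enc ((0, a) : nat * nat)%N) s = atom_val q L v a s.
Proof. by elim: k => [|k IHk] /=; rewrite encK. Qed.

Lemma represented_one n : represented (fun _ : n.-tuple nat => 1).
Proof.
exists (enc ((0, enc ((0, (0, [::])) : nat * (nat * seq nat))) : nat * nat)%N), 0%N.
move=> k _ s; rewrite code_val_atom /atom_val encK.
by case: asboolP => // -[].
Qed.

Lemma represented_sub n (g h : n.-tuple nat -> R) :
  represented g -> represented h ->
  represented (fun s => Num.max (g s - h s) 0).
Proof.
move=> [u [k1 uP]] [w [k2 wP]].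
exists (enc ((1, enc ((u, w) : nat * nat)) : nat * nat)%N), (maxn k1 k2).+1.
case=> // k; rewrite ltnS geq_max => /andP[k1k k2k] s.
by rewrite /= encK /= encK /= uP // wP.
Qed.

Lemma represented_scale n m l (g : n.-tuple nat -> R) : represented g ->
  represented (fun s => Num.min (thr (m.+1, l) * g s) 1).
Proof.
move=> [u [k1 uP]].
exists (enc ((2, enc ((m, (l, u)) : nat * (nat * nat))) : nat * nat)%N), k1.+1.
by case=> // k; rewrite ltnS => k1k s; rewrite /= encK /= encK /= uP.
Qed.

Lemma represented_inf n (g : n.+1.-tuple nat -> R) : represented g ->
  represented (fun s => inf (range (fun x => g (rcons_tuple s x)))).
Proof.
move=> [u [k1 uP]]; exists (enc ((3, u) : nat * nat)%N), k1.+1.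
case=> // k; rewrite ltnS => k1k s; rewrite /= encK /=.
congr inf; apply: eq_imagel => x _.
by rewrite -(uP k) //= rev_rcons.
Qed.

Lemma represented_neg n (g : n.-tuple nat -> R) : (forall s, g s <= 1) ->
  represented g -> represented (fun s => 1 - g s).
Proof.
move=> g_le1 rg.
apply: (represented_ext _ (represented_sub (represented_one n) rg)) => s.
by rewrite max_l // subr_ge0.
Qed.

(** With truncated differences and nonnegative values, the minimum is [g - (g - h)]. *)
Lemma represented_min n (g h : n.-tuple nat -> R) :
  (forall s, 0 <= g s) -> (forall s, 0 <= h s) ->
  represented g -> represented h -> represented (fun s => Num.min (g s) (h s)).
Proof.
move=> g_ge0 h_ge0 rg rh; apply: (represented_ext _ (represented_sub rg (represented_sub rg rh))).
move=> s; have := g_ge0 s; have := h_ge0 s.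
case: (leP (g s) (h s)) => gh ? ?.
  by rewrite (max_r (x := g s - h s)) ?subr0 ?max_l // subr_le0.
by rewrite (max_l (x := g s - h s)) ?subr_ge0 ?ltW // subKr max_l.
Qed.

Lemma atom_rel n (j : symbol L) (o : (ar j).-tuple 'I_n) (s : n.-tuple nat) :
  atom_val q L v (enc ((2, (sval j, [seq val i | i <- o])) : nat * (nat * seq nat))%N)
    (rev s) = evalq M q (CRel o) s.
Proof.
rewrite /atom_val encK /=; do 2 case: asboolP => // _.
case: asboolP => [_|[]].
  rewrite revK; pose t := map_tuple (tnth s) o.
  have -> : [seq nth 0%N s i | i <- [seq val i | i <- o]] = t.
    by rewrite -map_comp; apply: eq_map => i /=; rewrite (tnth_nth 0%N).
  rewrite Mv /evalq /=; congr interp; apply: eq_from_tnth => i.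
  by rewrite !tnth_map.
split; first by split; [exact: (svalP j) | rewrite size_map size_tuple].
by move=> _ /mapP[i _ ->]; rewrite size_rev size_tuple.
Qed.

Lemma atom_dist n (i j : 'I_n) (s : n.-tuple nat) :
  atom_val q L v (enc ((1, (0, [:: val i; val j])) : nat * (nat * seq nat))%N)
    (rev s) = evalq M q (CDist L i j) s.
Proof.
rewrite /atom_val encK /=; case: asboolP => // _; case: asboolP => [_|[]//].
case: asboolP => [_|[]]; last by rewrite size_rev size_tuple !ltn_ord.
by rewrite revK /evalq /= !tnth_map !(tnth_nth 0%N).
Qed.

(** By duality the maximum is [1 - min (1 - g) (1 - h)]; the values must not exceed 1 for the
    negations to be truncated differences from 1. *)
Lemma represented_max n (g h : n.-tuple nat -> R) :
  (forall s, 0 <= g s <= 1) -> (forall s, 0 <= h s <= 1) ->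
  represented g -> represented h -> represented (fun s => Num.max (g s) (h s)).
Proof.
move=> g_range h_range rg rh.
have neg_ge0 (x : R) : 0 <= x <= 1 -> 0 <= 1 - x by move=> /andP[]; rewrite subr_ge0.
have [g_le1 h_le1] : (forall s, g s <= 1) /\ (forall s, h s <= 1).
  by split=> s; [have /andP[] := g_range s | have /andP[] := h_range s].
have r := represented_min (fun s => neg_ge0 _ (g_range s))
  (fun s => neg_ge0 _ (h_range s)) (represented_neg g_le1 rg)
  (represented_neg h_le1 rh).
apply: (represented_ext _ (represented_neg _ r)) => s; last first.
  by rewrite ge_min gerBl; have /andP[->] := g_range s.
case: (leP (g s) (h s)) => gh; case: leP => ?; lra.
Qed.

Let evalq_ge0 n (f : formula L n) s : 0 <= evalq M q f s.
Proof. exact: (formula_val_ge0 M (q 0%N) mdist_le1). Qed.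

Let evalq_le1 n (f : formula L n) s : evalq M q f s <= 1.
Proof. exact: (formula_val_le1 M (q 0%N) mdist_le1). Qed.

Lemma evalq_inf n (f : formula L n.+1) s :
  evalq M q (CInf f) s = inf (range (fun m => evalq M q f (rcons_tuple s m))).
Proof.
rewrite /evalq (inf_dense M (q 0%N) mdist_le1 f (map_tuple q s) dense_q).
congr inf; apply: eq_imagel => m _; congr formula_val.
by apply: val_inj; rewrite /= map_rcons.
Qed.

Lemma formula_represented n (f : formula L n) : represented (evalq M q f).
Proof.
elim: f => {n} /= [n|n|n i j|n j o|n f IHf|n f IHf g IHg|n f IHf g IHg
  |n f IHf g IHg|n f IHf g IHg|n f IHf|n f IHf g IHg|n r r0 f IHf|n f IHf
  |n f IHf].
- apply: (represented_ext _ (represented_neg (fun=> lexx _) (represented_one n))).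
  by move=> s; rewrite subrr.
- exact: represented_one.
- exists (enc ((0, enc ((1, (0, [:: val i; val j])) : nat * (nat * seq nat)))
    : nat * nat)%N), 0%N.
  by move=> k _ s; rewrite code_val_atom atom_dist.
- exists (enc ((0, enc ((2, (sval j, [seq val i | i <- o]))
    : nat * (nat * seq nat))) : nat * nat)%N), 0%N.
  by move=> k _ s; rewrite code_val_atom atom_rel.
(* The entries 0 and 1 stand for the factor 1/2 because both are shifted by one; the truncation at 1
   has no effect on half of a value. *)
- apply: (represented_ext _ (represented_scale 0 1 IHf)) => s.
  have -> : thr (1, 1)%N = 2^-1 :> R by rewrite /thr div1r.
  change (evalq M q (CHalf f) s) with (evalq M q f s / 2).
  move: (evalq_ge0 f s) (evalq_le1 f s); move: (evalq M q f s) => x x0 x1.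
  by case: leP; lra.
- exact: (represented_sub IHf IHg).
- exact: (represented_min (evalq_ge0 f) (evalq_ge0 g) IHf IHg).
- apply: (represented_max _ _ IHf IHg) => s; by rewrite evalq_ge0 evalq_le1.
- have subt_range (x y : R) : 0 <= x -> x <= 1 -> 0 <= y -> 0 <= Num.max (x - y) 0 <= 1.
    by move=> ? ? ?; rewrite le_max lexx orbT ge_max ler01 andbT; lra.
  have r := represented_max (fun s => subt_range _ _ (evalq_ge0 f s) (evalq_le1 f s)
    (evalq_ge0 g s)) (fun s => subt_range _ _ (evalq_ge0 g s) (evalq_le1 g s)
    (evalq_ge0 f s)) (represented_sub IHf IHg) (represented_sub IHg IHf).
  apply: (represented_ext _ r) => s.
  change (evalq M q (CAbsDiff f g) s) with `|evalq M q f s - evalq M q g s|.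
  move: (evalq M q f s) (evalq M q g s) => x y.
  case: (leP x y) => [fg|/ltW fg].
    rewrite (max_r (y := 0)) ?subr_le0 // (max_l (y := 0)) ?subr_ge0 //.
    by rewrite max_r ?subr_ge0 // ler0_norm ?subr_le0 // opprB.
  rewrite (max_l (y := 0)) ?subr_ge0 // (max_r (y := 0)) ?subr_le0 //.
  by rewrite max_l ?subr_ge0 // ger0_norm // subr_ge0.
- exact: (represented_neg (evalq_le1 f) IHf).
(* The truncated sum is [1 - ((1 - f) - g)], where the inner difference is truncated at 0. *)
- have r := represented_sub (represented_neg (evalq_le1 f) IHf) IHg.
  apply: (represented_ext _ (represented_neg _ r)) => s; last first.
    by rewrite ge_max ler01 andbT; have := evalq_ge0 f s; have := evalq_ge0 g s; lra.
  change (evalq M q (CAdd f g) s) with (Num.min (evalq M q f s + evalq M q g s) 1).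
  move: (evalq M q f s) (evalq M q g s) => x y.
  by case: leP => ?; case: leP => ?; lra.
(* The predecessors compensate for the shifts; the numerator is nonzero since [r] is positive. *)
- apply: (represented_ext _ (represented_scale `|numq r|.-1 `|denq r|.-1 IHf)) => s.
  change (evalq M q (CScale r0 f) s) with (Num.min (ratr r * evalq M q f s) 1).
  rewrite -(rat_thrE (ltW r0)) /rat_thr prednK //.
  by rewrite absz_gt0 numq_eq0 gt_eqF.
- have r := represented_inf (represented_neg (evalq_le1 f) IHf).
  have rE : (fun s => inf (range (fun x => 1 - evalq M q f (rcons_tuple s x)))) =
      evalq M q (CInf (CNeg f)).
    by apply/funext => s; rewrite evalq_inf.
  rewrite rE in r.
  apply: (represented_ext _ (represented_neg (evalq_le1 (CInf (CNeg f))) r)) => s.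
  by rewrite [in RHS]/evalq (formula_val_sup_inf M (q 0%N) mdist_le1).
- by apply: (represented_ext _ (represented_inf IHf)) => s; rewrite evalq_inf.
Qed.

(** The converse direction, by which a quantifier over all codes does not leave the set of formulas.
    Distance and predicate atoms with variables out of range, or with arguments that do not fit the
    signature, have the value 0 and are taken to [CZero]. *)
Lemma represented_formula k u n : exists f : formula L n,
  forall s : n.-tuple nat, val_ k u (rev s) = evalq M q f s.
Proof.
elim: k u n => [|k IHk] u n /=.
  case: (uncode u : nat * nat) => _ a /=.
  rewrite -(uncodeK (T := (nat * (nat * seq nat))%type) a).
  case: (uncode a) => t [j args] {a}.
  have zero : (forall s : n.-tuple nat, atom_val q L v
      (enc ((t, (j, args)) : nat * (nat * seq nat))) (rev s) = 0) ->
      exists f : formula L n, forall s : n.-tuple nat, atom_val q L v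
      (enc ((t, (j, args)) : nat * (nat * seq nat))) (rev s) = evalq M q f s.
    by move=> v0; exists (CZero L n) => s; rewrite v0.
  have [t0|t0] := eqVneq t 0%N.
    exists (COne L n) => s; rewrite /atom_val encK /= t0.
    by case: asboolP.
  have [t1|t1] := eqVneq t 1%N.
    have [[i_n j_n]|out] := pselect ((nth 0%N args 0 < n)%N /\ (nth 0%N args 1 < n)%N).
      exists (CDist L (Ordinal i_n) (Ordinal j_n)) => s.
      rewrite -atom_dist /atom_val !encK /= t1.
      by do 3 case: asboolP => //.
    apply: zero => s; rewrite /atom_val encK /= t1.
    do 2 case: asboolP => // _.
    by case: asboolP => //; rewrite size_rev size_tuple => /out.
  have tE t' (x y z : R) : t' != 0%N -> t' != 1%N ->
      (if `[<t' = 0%N>] then x else if `[<t' = 1%N>] then y else z) = z.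
    by move=> /eqP t'0 /eqP t'1; do 2 case: asboolP => // _.
  have [[/valid_argsP[js [a' [jE aE]]] args_n]|out] :=
    pselect (valid_args L j args /\ forall i, i \in args -> (i < n)%N).
    have [ords oE] : exists ords : seq 'I_n, [seq val i | i <- ords] = args.
      elim: (args) args_n => [|i l IHl] l_n; first by exists [::].
      have [x xl|ords oE] := IHl; first by apply: l_n; rewrite inE xl orbT.
      by exists (Ordinal (l_n i (mem_head _ _)) :: ords); rewrite /= oE.
    have o_size : size ords == ar js by rewrite -(size_map val) oE -aE size_tuple.
    exists (CRel (Tuple o_size)) => s; rewrite -atom_rel /= oE jE.
    by rewrite /atom_val !encK /= !tE.
  apply: zero => s; rewrite /atom_val encK /= tE //.
  by case: asboolP => //; rewrite size_rev size_tuple => /out.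
case: (uncode u : nat * nat) => -[|[|[|m]]] arg /=; first exact: IHk.
- case: (uncode arg : nat * nat) => u1 u2 /=.
  have [f fP] := IHk u1 n; have [g gP] := IHk u2 n.
  by exists (CSub f g) => s; rewrite fP gP.
- case: (uncode arg : nat * (nat * nat)) => m [l w] /=.
  have [f fP] := IHk w n.
  have r_gt0 : 0 < rq (m.+1, l) by rewrite /rq divr_gt0.
  by exists (CScale r_gt0 f) => s; rewrite /evalq /= ratr_rq fP.
- have [f fP] := IHk arg n.+1.
  exists (CInf f) => s; rewrite evalq_inf; congr inf.
  by apply: eq_imagel => x _; rewrite -fP /= rev_rcons.
Qed.

End FormulaCodes.

(** * The class SC expressed through codes *)

Section SCCodes.
Local Open Scope ring_scope.
Context {R : realType} {U : metricType R} {L : signature}.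
Variable q : nat -> U.

(* [Defs.SC] with formulas replaced by their codes [(k, u)], and tuples by the
   reversed lists of their entries. *)
Definition SC_code (val_ : nat -> nat -> seq nat -> R) : Prop :=
  forall (n : nat) (eps : nat * nat), (0 < eps.1)%N ->
  exists l : seq (nat * (nat * (nat * nat))),
    (forall c, c \in l ->
      exists s, size s = n /\ val_ c.1 c.2.1 s <= thr c.2.2) /\
    (forall s, size s = n ->
      exists c, c \in l /\ val_ c.1 c.2.1 s <= thr c.2.2) /\
    (forall c, c \in l -> forall a, size a = n -> val_ c.1 c.2.1 a <= thr c.2.2 ->
      forall s, size s = n -> val_ c.1 c.2.1 s <= thr c.2.2 ->
      forall x (D : seq (nat * nat)),
        (forall y, y \in D -> val_ y.1 y.2 (x :: s) <= thr (0, 0)%N) ->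
      exists b x', size b = n /\
        (forall i, (i < n)%N -> qdist q (nth 0%N a i) (nth 0%N b i) <= thr eps) /\
        (forall y, y \in D -> val_ y.1 y.2 (x' :: b) <= thr (0, 0)%N)).

Lemma rev_tupleP n (s : seq nat) : size s = n ->
  exists t : n.-tuple nat, s = rev t.
Proof.
move=> size_s; have size_r : size (rev s) == n by rewrite size_rev size_s.
by exists (Tuple size_r); rewrite /= revK.
Qed.

Lemma nth_rev_tuple n (t : n.-tuple nat) (i : 'I_n) :
  nth 0%N (rev t) i = tnth t (rev_ord i).
Proof. by rewrite nth_rev ?size_tuple // (tnth_nth 0%N). Qed.

Lemma bigmax_ord_le n (F : 'I_n -> R) r : 0 <= r ->
  \big[Num.max/0]_(j < n) F j <= r <-> forall j, F j <= r.
Proof.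
move=> r_ge0; split=> [le_r j|le_r].
  by apply: le_trans le_r; apply: le_bigmax_cond.
by apply/bigmax_leP; split.
Qed.

(** Formulas enter [SC] only through their values on the sequence, so it suffices that each formula
    has a code and each code a formula. As values are nonnegative, the condition of being 0 becomes
    a comparison with the threshold 0. *)
Lemma SC_codeP (M : lstructure U L) (val_ : nat -> nat -> seq nat -> R) :
  (forall n (f : formula L n) s, 0 <= evalq M q f s) ->
  (forall n (f : formula L n), exists k u, forall s : n.-tuple nat,
     val_ k u (rev s) = evalq M q f s) ->
  (forall k u n, exists f : formula L n, forall s : n.-tuple nat,
     val_ k u (rev s) = evalq M q f s) ->
  SC M q <-> SC_code val_.
Proof.
move=> eval_ge0 code_of formula_of.
have close_rev n (a b : n.-tuple nat) e : 0 <= e ->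
    \big[Num.max/0]_(j < n) qdist q (tnth a j) (tnth b j) <= e <->
    forall i, (i < n)%N -> qdist q (nth 0%N (rev a) i) (nth 0%N (rev b) i) <= e.
  move=> e_ge0; rewrite bigmax_ord_le //; split=> [ab i lt_i|ab j].
    by have := ab (rev_ord (Ordinal lt_i)); rewrite -!nth_rev_tuple.
  by have := ab (rev_ord j) (ltn_ord _); rewrite !nth_rev_tuple rev_ordK.
split=> [scM n eps eps_gt0|scM n eps eps_gt0].
  have rq_gt0 : 0 < rq eps by rewrite /rq divr_gt0 ?ltr0n.
  have [k [abar [f [delta [fa cover homog]]]]] := scM n _ rq_gt0.
  (* [delta i] bounds the nonnegative value at [abar i], so it is the value of a threshold. *)
  have delta_ge0 i : 0 <= delta i.
    by rewrite -(ler0q R); apply: le_trans (fa i).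
  have /choice[cf cfP] : forall i, exists c : nat * nat,
      forall s : n.-tuple nat, val_ c.1 c.2 (rev s) = evalq M q (f i) s.
    move=> i; by have [k' [u kuP]] := code_of _ (f i); exists (k', u).
  pose cond i := ((cf i).1, ((cf i).2, rat_thr (delta i))).
  have condP i (s : n.-tuple nat) :
      val_ (cond i).1 (cond i).2.1 (rev s) <= thr (cond i).2.2 <->
      evalq M q (f i) s <= ratr (delta i).
    by rewrite /cond /= cfP rat_thrE.
  exists [seq cond i | i <- enum 'I_k]; split; last split.
  - move=> _ /mapP[i _ ->]; exists (rev (abar i)).
    by rewrite size_rev size_tuple; split=> //; apply/condP.
  - move=> s /rev_tupleP[t ->]; have [i fi] := cover t.
    by exists (cond i); split; [apply: map_f; rewrite mem_enum | apply/condP].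
  - move=> _ /mapP[i _ ->] a /rev_tupleP[ta ->] /condP fta s /rev_tupleP[ts ->].
    move=> /condP fts x D Dx.
    have /choice[F FP] : forall y : nat * nat, exists g : formula L n.+1,
        forall s : n.+1.-tuple nat, val_ y.1 y.2 (rev s) = evalq M q g s.
      by move=> y; exact: formula_of.
    have FE y (t : n.-tuple nat) z :
        val_ y.1 y.2 (z :: rev t) = evalq M q (F y) (rcons_tuple t z).
      by rewrite -FP /= rev_rcons.
    have [j|b [b' [close_b Fb]]] := homog i ta fta ts x fts (size D)
        (fun j => F (tnth (in_tuple D) j)).
      apply/eqP; rewrite eq_le eval_ge0 andbT -FE.
      by rewrite -[leRHS]thr0; apply: Dx; apply: mem_tnth.
    exists (rev b), b'; rewrite size_rev size_tuple; split=> //; split.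
      by rewrite -ratr_rq; apply/close_rev => //; rewrite ler0q ltW.
    move=> y yD; rewrite FE thr0.
    have /tnthP[j ->] : y \in in_tuple D by [].
    by rewrite Fb.
have num_gt0 : (0 < (rat_thr eps).1)%N by rewrite /= absz_gt0 numq_eq0 gt_eqF.
have thr_eps : thr (rat_thr eps) = ratr eps :> R by rewrite rat_thrE // ltW.
have [l [nonempty [cover homog]]] := scM n _ num_gt0.
pose cond (i : 'I_(size l)) := tnth (in_tuple l) i.
have cond_l i : cond i \in l by apply: mem_tnth.
have /choice[F FP] : forall i, exists g : formula L n, forall s : n.-tuple nat,
    val_ (cond i).1 (cond i).2.1 (rev s) = evalq M q g s.
  by move=> i; exact: formula_of.
have /choice[abar abarP] : forall i, exists t : n.-tuple nat,
    evalq M q (F i) t <= thr (cond i).2.2.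
  move=> i; have [s [/rev_tupleP[t ->] sP]] := nonempty _ (cond_l i).
  by exists t; rewrite -FP.
exists (size l), abar, F, (fun i => rq (cond i).2.2); split=> [i|s|].
- by rewrite ratr_rq.
- have [|c [/(tnthP (in_tuple l))[i ->] cs]] := cover (rev s).
    by rewrite size_rev size_tuple.
  by exists i; rewrite ratr_rq -FP.
move=> i a; rewrite ratr_rq -FP => Fa c c'; rewrite -FP => Fc m Delta Dc.
have /choice[cD cDP] : forall j, exists y : nat * nat,
    forall s : n.+1.-tuple nat, val_ y.1 y.2 (rev s) = evalq M q (Delta j) s.
  move=> j; by have [k [u kuP]] := code_of _ (Delta j); exists (k, u).
have cDE j (t : n.-tuple nat) z : val_ (cD j).1 (cD j).2 (z :: rev t) =
    evalq M q (Delta j) (rcons_tuple t z).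
  by rewrite -cDP /= rev_rcons.
have size_r (t : n.-tuple nat) : size (rev t) = n by rewrite size_rev size_tuple.
have [|_ [b' [/rev_tupleP[b ->] [close_b Db]]]] := homog _ (cond_l i) _ (size_r a)
    Fa _ (size_r c) Fc c' [seq cD j | j <- enum 'I_m].
  by move=> _ /mapP[j _ ->]; rewrite cDE Dc thr0.
exists b, b'; split.
  by rewrite -thr_eps; apply/close_rev => //; apply: thr_ge0.
move=> j; apply/eqP; rewrite eq_le eval_ge0 andbT -cDE -[leRHS]thr0.
by apply: Db; apply: map_f; rewrite mem_enum.
Qed.

End SCCodes.

(** * Complexity of SC on indices and the final count of jumps *)

Section Main.
Local Open Scope ring_scope.
Context {R : realType} {U : metricType R}.
Variables (q : nat -> U) (L : signature).
Hypothesis comp_L : computable_signature L.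
Hypothesis dec_q : decidable_presentation q.
Hypothesis dist_le1 : forall m n, qdist q m n <= 1.

Let ival e := code_val (R := R) (atom_val q L (index_val e)).

Lemma arithr_jump_omega {T} {cT : coded T} (f : T -> R) :
  arithr (A := set0) f -> arithr (A := jump_omega) f.
Proof. exact: arith_jump_omega. Qed.

Lemma arithr_code_val {T} {cT : coded T} (e k u : T -> nat) (s : T -> seq nat) :
  arithf jump_omega e -> arithf jump_omega k -> arithf jump_omega u ->
  arithf jump_omega s ->
  arithr (A := jump_omega) (fun x => ival (e x) (k x) (u x) (s x)).
Proof.
move=> re rk ru rs; apply: (arith_comp (arith_code_val comp_L dec_q dist_le1)
  (f := fun z => (k z.1, (e z.1, (u z.1, (s z.1, z.2)))))).
by arith.
Qed.

Lemma arith_code_val_le {T} {cT : coded T} (e k u : T -> nat)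
    (s : T -> seq nat) (d : T -> nat * nat) :
  arithf jump_omega e -> arithf jump_omega k -> arithf jump_omega u ->
  arithf jump_omega s -> arithf jump_omega d ->
  arith jump_omega (fun x => ival (e x) (k x) (u x) (s x) <= thr (d x)).
Proof.
move=> re rk ru rs rd; apply: arith_le => [x||]; first exact: thr_ge0.
  exact: arithr_code_val.
exact: arithr_thr.
Qed.

Lemma arith_SC_code : arith jump_omega (fun e => SC_code q (ival e)).
Proof.
rewrite /SC_code; do 2 apply: arith_all; apply: arith_imp; first by arith.
apply: arith_ex; apply: arith_and; last apply: arith_and.
- apply: arith_all; apply: arith_imp; first by arith.
  apply: arith_ex; apply: arith_and; first by arith.
  by apply: arith_code_val_le; arith.
- apply: arith_all; apply: arith_imp; first by arith.
  apply: arith_ex; apply: arith_and; first by arith.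
  by apply: arith_code_val_le; arith.
- apply: arith_all; apply: arith_imp; first by arith.
  apply: arith_all; apply: arith_imp; first by arith.
  apply: arith_imp; first by apply: arith_code_val_le; arith.
  apply: arith_all; apply: arith_imp; first by arith.
  apply: arith_imp; first by apply: arith_code_val_le; arith.
  do 2 apply: arith_all; apply: arith_imp.
    apply: arith_all; apply: arith_imp; first by arith.
    by apply: arith_code_val_le; arith.
  do 2 apply: arith_ex; apply: arith_and; first by arith.
  apply: arith_and; apply: arith_all; apply: arith_imp; try by arith.
    apply: arith_le => [x||]; first exact: thr_ge0.
      apply: (arithr_comp (h := fun z : nat * nat => qdist q z.1 z.2)
        (u := fun z => (_, _))).
        by apply: arithr_jump_omega; apply: arithr_qdist => //; arith.
      by arith.
    by apply: arithr_thr; arith.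
  by apply: arith_code_val_le; arith.
Qed.

End Main.

Theorem proposition5p4 (R : realType) (U : metricType R) (q : nat -> U)
    (L : signature)
    (hU : urysohn1 U)
    (hq : rational_urysohn1 q)
    (hemb : good_embedding q)
    (hdec : decidable_presentation q)
    (hL : computable_signature L) :
  hyperarithmetical (SC_indices q L).
Proof.
have mdist_le1 (x y : U) := urysohn1_le1 x y hU.
have dist_le1 m n := mdist_le1 (q m) (q n).
have [dense_q _ _] := hemb.
(* The right-hand side mentions only [e]: membership of the structure in the class is a property of
   any of its indices. *)
have SC_indexE (M : lstructure U L) e : index_of q M e ->
    SC M q <-> SC_code q (code_val (R := R) (atom_val q L (index_val e))).
  move=> /index_val_values Mv; apply: SC_codeP => [n f s|n f|k u n].
  - exact: (formula_val_ge0 M (q 0) mdist_le1).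
  - have [u [k ukP]] := formula_represented mdist_le1 dense_q Mv f.
    by exists k, u => s; rewrite (ukP k).
  - exact: represented_formula mdist_le1 dense_q Mv k u n.
apply: arith_hyperarithmetical.
have := arith_and (arith_jump_omega (arith_structure_index hL hdec dist_le1))
  (arith_SC_code hL hdec dist_le1).
apply: arith_ext => e; split=> [[/structure_indexP[M eM] sc]|[M [_ sc eM]]].
  by exists M; split; [exists e | apply/(SC_indexE M e eM) |].
split; last exact/(SC_indexE M e eM).
by apply/structure_indexP; exists M.
Qed.
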